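(* Let $k$ be a commutative ring and $\mathfrak{a}$ a cdg-category over $k$. The Yoneda embedding $Y:\mathfrak{a}\to\mathrm{Mod}_{qdg}(\mathfrak{a})$, $A\mapsto\mathfrak{a}(-,A)$, $g\mapsto(g\circ-)$, has an extension $$\hat Y:\mathrm{Free}(\mathfrak{a})_{con}\to\mathrm{Mod}_{qdg}(\mathfrak{a})$$ which is a fully faithful strict cdg-embedding with the graded free qdg-modules as essential image.
   Context: A cdg-category $\mathfrak{a}$ over $k$ consists of a set of objects, $\mathbb{Z}$-graded $k$-modules $\mathfrak{a}(A,B)$, an associative $k$-bilinear composition $\mu_2$ of degree 0, degree 1 maps $d=\mu_1:\mathfrak{a}(A,B)\to\mathfrak{a}(A,B)$ satisfying the graded Leibniz rule, and curvature elements $c_A=(\mu_0)_A\in\mathfrak{a}(A,A)^2$ with $d(c_A)=0$ and $d^2(f)=c_Bf-fc_A$ for $f\in\mathfrak{a}(A,B)$ (i.e. it is a curved $A_\infty$-category with $\mu_n=0$ for $n\geq 3$; the existence of units is not part of this definition). A strict cdg-functor is a map on objects together with degree 0 $k$-linear maps on Hom-modules compatible with composition, commuting with $d$ and sending curvatures to curvatures. It is fully faithful if it is bijective on Hom-modules; its essential image consists of all objects that are isomorphic, by a degree 0 isomorphism annihilated by $d$, to an object in the image. $\mathrm{Free}(\mathfrak{a})$ has as objects formal sums $M=\oplus_{i\in I}\Sigma^{m_i}A_i$ ($I$ any set, $A_i\in\mathfrak{a}$, $m_i\in\mathbb{Z}$), and for $N=\oplus_j\Sigma^{n_j}B_j$,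 $\mathrm{Free}(\mathfrak{a})(M,N)=\prod_i\oplus_j\Sigma^{n_j-m_i}\mathfrak{a}(A_i,B_j)$, where $(\Sigma V)^n=V^{n+1}$; the cdg-structure of $\mathfrak{a}$ extends as in matrix multiplication (with the usual shift signs). $\mathrm{Free}(\mathfrak{a})_{con}$ has objects $(M,\delta_M)$ with $\delta_M\in\mathrm{Free}(\mathfrak{a})(M,M)^1$ arbitrary, the same graded Homs and composition, differential $f\mapsto d(f)+\delta_Nf-(-1)^{|f|}f\delta_M$ and curvature $c_M+d(\delta_M)+\delta_M^2$ at $(M,\delta_M)$. $\mathfrak{a}$ embeds via $A\mapsto(A,0)$; ''extension'' means that $\hat Y$ restricts to $Y$ along this embedding. A qdg-module $M$ over $\mathfrak{a}$ (right module) consists of $\mathbb{Z}$-graded $k$-modules $M(A)$ with a contravariant graded $k$-linear action of $\mathfrak{a}$ compatible with composition (write $xf$ for the action), and degree 1 maps $d:M(A)\to M(A)$ with $d(xf)=d(x)f+(-1)^{|x|}x\,d(f)$; no condition is imposed on $d^2$. (Equivalently, a strict qdg-functor, i.e. a strict cdg-functor without the requirement on curvatures, from $\mathfrak{a}^{op}$ to the cdg-category of precomplexes of $k$-modules.) $\mathrm{Mod}_{qdg}(\mathfrak{a})$ is the cdg-category with $\mathrm{Hom}(M,N)$ the graded module of graded natural transformations $\rho=(\rho_A)$ (of all degrees), differential $\rho\mapsto d_N\rho-(-1)^{|\rho|}\rho d_M$, and curvature of $M$ given by $x\mapsto d^2(x)+xc_A$ for $x\in M(A)$. The representable qdg-module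 $\mathfrak{a}(-,A)$ has $B\mapsto(\mathfrak{a}(B,A),d)$ with action by composition. A qdg-module is graded free if its underlying graded module is isomorphic to a direct sum of shifts of representable graded modules.
   Formalization: The cdg-category is assumed to have strict two-sided units of degree 0; without them the claim fails (one object, Hom k with zero multiplication gives Y = 0), and a fully faithful extension of Y forces units to exist. *)

(* Defs.v *)
From HB Require Import structures.
From mathcomp Require Import all_boot all_order all_algebra.
From mathcomp Require Import zify.
From mathcomp Require Import finmap boolp classical_sets functions cardinality fsbigop.

Set Implicit Arguments.
Unset Strict Implicit.
Unset Printing Implicit Defensive.

Import GRing.Theory.
Local Open Scope classical_set_scope.
Local Open Scope ring_scope.

Section Product.
Variables (k : comPzRingType) (I : Type) (V : I -> lmodType k).

Definition lprod : Type := forall i, V i.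

Implicit Types f g h : lprod.

Definition lprod_add f g : lprod := fun i => f i + g i.
Definition lprod_zero : lprod := fun=> 0.
Definition lprod_opp f : lprod := fun i => - f i.
Definition lprod_scale (c : k) f : lprod := fun i => c *: f i.

Fact lprod_addA : associative lprod_add.
Proof. by move=> f g h; apply: functional_extensionality_dep => i; exact: addrA. Qed.
Fact lprod_addC : commutative lprod_add.
Proof. by move=> f g; apply: functional_extensionality_dep => i; exact: addrC. Qed.
Fact lprod_add0 : left_id lprod_zero lprod_add.
Proof. by move=> f; apply: functional_extensionality_dep => i; exact: add0r. Qed.
Fact lprod_addN : left_inverse lprod_zero lprod_opp lprod_add.
Proof. by move=> f; apply: functional_extensionality_dep => i; exact: addNr. Qed.

HB.instance Definition _ := gen_eqMixin lprod.
HB.instance Definition _ := gen_choiceMixin lprod.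
HB.instance Definition _ :=
  GRing.isZmodule.Build lprod lprod_addA lprod_addC lprod_add0 lprod_addN.

Fact lprod_scaleA c d f : lprod_scale c (lprod_scale d f) = lprod_scale (c * d) f.
Proof. by apply: functional_extensionality_dep => i; exact: scalerA. Qed.
Fact lprod_scale1 : left_id 1 lprod_scale.
Proof. by move=> f; apply: functional_extensionality_dep => i; exact: scale1r. Qed.
Fact lprod_scaleDr : right_distributive lprod_scale +%R.
Proof. by move=> c f g; apply: functional_extensionality_dep => i; exact: scalerDr. Qed.
Fact lprod_scaleDl f : {morph lprod_scale^~ f : c d / c + d}.
Proof. by move=> c d; apply: functional_extensionality_dep => i; exact: scalerDl. Qed.

HB.instance Definition _ :=
  GRing.Zmodule_isLmodule.Build k lprod lprod_scaleA lprod_scale1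
    lprod_scaleDr lprod_scaleDl.

End Product.

Section DirectSum.
Variables (k : comPzRingType) (I : Type) (V : I -> lmodType k).

Record dsum : Type := DSum {
  dsum_val :> forall i, V i;
  dsum_fin : finite_set [set i | dsum_val i <> 0]
}.

Implicit Types f g h : dsum.

Lemma dsumP f g : (forall i, f i = g i) -> f = g.
Proof.
case: f g => [f pf] [g pg] /= fg.
have {}fg : f = g by apply: functional_extensionality_dep.
by case: _ / fg pg => pg; rewrite (Prop_irrelevance pf pg).
Qed.

Fact dsum_add_fin f g : finite_set [set i | f i + g i <> 0].
Proof.
apply: (@sub_finite_set _ _ ([set i | f i <> 0] `|` [set i | g i <> 0])).
  move=> i /= fg0; case: (pselect (f i = 0)) => f0; last by left.
  by right=> g0; apply: fg0; rewrite f0 g0 addr0.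
by rewrite finite_setU; split; exact: dsum_fin.
Qed.
Definition dsum_add f g : dsum := DSum (dsum_add_fin f g).

Fact dsum_zero_fin : finite_set [set i | (0 : V i) <> 0].
Proof. by apply: (@sub_finite_set _ _ set0) => // i /=. Qed.
Definition dsum_zero : dsum := DSum dsum_zero_fin.

Fact dsum_opp_fin f : finite_set [set i | - f i <> 0].
Proof.
apply: sub_finite_set (dsum_fin f) => i /= fi0 f0.
by apply: fi0; rewrite f0 oppr0.
Qed.
Definition dsum_opp f : dsum := DSum (dsum_opp_fin f).

Fact dsum_scale_fin (c : k) f : finite_set [set i | c *: f i <> 0].
Proof.
apply: sub_finite_set (dsum_fin f) => i /= fi0 f0.
by apply: fi0; rewrite f0 scaler0.
Qed.
Definition dsum_scale (c : k) f : dsum := DSum (dsum_scale_fin c f).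

Fact dsum_addA : associative dsum_add.
Proof. by move=> f g h; apply: dsumP => i; exact: addrA. Qed.
Fact dsum_addC : commutative dsum_add.
Proof. by move=> f g; apply: dsumP => i; exact: addrC. Qed.
Fact dsum_add0 : left_id dsum_zero dsum_add.
Proof. by move=> f; apply: dsumP => i; exact: add0r. Qed.
Fact dsum_addN : left_inverse dsum_zero dsum_opp dsum_add.
Proof. by move=> f; apply: dsumP => i; exact: addNr. Qed.

HB.instance Definition _ := gen_eqMixin dsum.
HB.instance Definition _ := gen_choiceMixin dsum.
HB.instance Definition _ :=
  GRing.isZmodule.Build dsum dsum_addA dsum_addC dsum_add0 dsum_addN.

Fact dsum_scaleA c d f : dsum_scale c (dsum_scale d f) = dsum_scale (c * d) f.
Proof. by apply: dsumP => i; exact: scalerA. Qed.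
Fact dsum_scale1 : left_id 1 dsum_scale.
Proof. by move=> f; apply: dsumP => i; exact: scale1r. Qed.
Fact dsum_scaleDr : right_distributive dsum_scale +%R.
Proof. by move=> c f g; apply: dsumP => i; exact: scalerDr. Qed.
Fact dsum_scaleDl f : {morph dsum_scale^~ f : c d / c + d}.
Proof. by move=> c d; apply: dsumP => i; exact: scalerDl. Qed.

HB.instance Definition _ :=
  GRing.Zmodule_isLmodule.Build k dsum dsum_scaleA dsum_scale1
    dsum_scaleDr dsum_scaleDl.

Definition dsum_in_val (i : I) (x : V i) : forall j, V j := fun j =>
  match pselect (i = j) with
  | left e => ecast j (V j) e x
  | right _ => 0
  end.

Fact dsum_in_fin i (x : V i) : finite_set [set j | dsum_in_val x j <> 0].
Proof.
apply: (@sub_finite_set _ _ [set i]); last exact: finite_set1.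
by move=> j /=; rewrite /dsum_in_val; case: pselect.
Qed.

Definition dsum_in i (x : V i) : dsum := DSum (dsum_in_fin x).

Lemma dsum_in_id i (x : V i) : dsum_in x i = x.
Proof.
rewrite /= /dsum_in_val; case: pselect => // e.
by rewrite (Prop_irrelevance e erefl).
Qed.

Lemma dsum_in_neq i (x : V i) j : i <> j -> dsum_in x j = 0.
Proof. by move=> ij; rewrite /= /dsum_in_val; case: pselect. Qed.

Lemma dsum_supp f : exists2 s : seq {classic I},
  uniq s & forall i : {classic I}, i \notin s -> f i = 0.
Proof.
exists (fset_set ([set i | f i <> 0] : set {classic I})); first exact: fset_uniq.
move=> i; rewrite in_fset_set; last exact: (dsum_fin f).
by rewrite notin_setE /= => /contrapT.
Qed.

End DirectSum.

(* [{classic I}] endows an arbitrary type with a choice structure, as needed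
   by finitely supported sums. *)
Lemma fsum_seq (I : Type) (W : zmodType) (s : seq {classic I}) (F : {classic I} -> W) :
  uniq s -> (forall i, i \notin s -> F i = 0) ->
  \sum_(i \in [set: {classic I}]) F i = \sum_(i <- s) F i.
Proof.
move=> us s0; rewrite (fsbigE s) //; last by move=> i _; exact: s0.
by apply: eq_bigl => i; rewrite in_setT.
Qed.

Lemma fsum_single (I : Type) (W : zmodType) (i0 : I) (F : {classic I} -> W) :
  (forall i, i0 <> i -> F i = 0) ->
  \sum_(i \in [set: {classic I}]) F i = F i0.
Proof.
move=> F0; rewrite (@fsum_seq _ _ [:: i0 : {classic I}]) ?big_seq1 //.
by move=> i; rewrite inE => /eqP ii0; apply: F0 => e; exact: ii0.
Qed.

Section Koszul.
Variable k : comPzRingType.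

(* [ksgn k n] is (-1)^n, for n a possibly negative degree. *)
Definition ksgn (n : int) : k := (-1) ^+ `|n|%N.

Lemma ksgn0 : ksgn 0 = 1. Proof. by []. Qed.

Lemma ksgn1 : ksgn 1 = -1. Proof. by rewrite /ksgn expr1. Qed.

Lemma ksgnD m n : ksgn (m + n) = ksgn m * ksgn n.
Proof.
rewrite /ksgn -exprD -signr_odd -[RHS]signr_odd; congr (_ ^+ nat_of_bool _).
lia.
Qed.

Lemma ksgnB m n : ksgn (m - n) = ksgn m * ksgn n.
Proof. by rewrite ksgnD; congr (_ * _); rewrite /ksgn; congr (_ ^+ _); lia. Qed.

Lemma ksgnS n : ksgn (n + 1) = - ksgn n.
Proof. by rewrite ksgnD ksgn1 mulrN1. Qed.

Lemma ksgnM n : ksgn n * ksgn n = 1.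
Proof. by rewrite -ksgnB subrr. Qed.

Lemma ksgnK (V : lmodType k) n (v : V) : ksgn n *: (ksgn n *: v) = v.
Proof. by rewrite scalerA ksgnM scale1r. Qed.

End Koszul.

(* A graded k-module is a family [V : int -> lmodType k].  Operations that
   change the degree take the degree of their result as a separate argument,
   together with an equation for it; as equality of integers is proof
   irrelevant, [cdg_comp] below is the same thing as a family of bilinear maps
   cdg_hom B C m * cdg_hom A B n -> cdg_hom A C (m + n).  Units are not part of the
   structure. *)
Record cdg_category (k : comPzRingType) (ob : Type) : Type := CDGCategory {
  cdg_hom : ob -> ob -> int -> lmodType k;
  cdg_comp : forall A B C (m n p : int), p = m + n ->
    cdg_hom B C m -> cdg_hom A B n -> cdg_hom A C p;
  cdg_dif : forall A B (n n' : int), n' = n + 1 -> cdg_hom A B n -> cdg_hom A B n';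
  cdg_curv : forall A, cdg_hom A A 2;
  comp_linear_l : forall A B C m n p (e : p = m + n) (f : cdg_hom A B n),
    linear (fun g : cdg_hom B C m => cdg_comp e g f);
  comp_linear_r : forall A B C m n p (e : p = m + n) (g : cdg_hom B C m),
    linear (fun f : cdg_hom A B n => cdg_comp e g f);
  compA : forall A B C D l m n lm mn lmn (e1 : mn = m + n) (e2 : lmn = l + mn)
      (e3 : lm = l + m) (e4 : lmn = lm + n)
      (h : cdg_hom C D l) (g : cdg_hom B C m) (f : cdg_hom A B n),
    cdg_comp e2 h (cdg_comp e1 g f) = cdg_comp e4 (cdg_comp e3 h g) f;
  dif_linear : forall A B n n' (e : n' = n + 1), linear (@cdg_dif A B n n' e);
  dif_comp : forall A B C m n p m' n' p' (e : p = m + n) (ep : p' = p + 1)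
      (em : m' = m + 1) (e1 : p' = m' + n) (en : n' = n + 1) (e2 : p' = m + n')
      (g : cdg_hom B C m) (f : cdg_hom A B n),
    cdg_dif ep (cdg_comp e g f) =
      cdg_comp e1 (cdg_dif em g) f + ksgn k m *: cdg_comp e2 g (cdg_dif en f);
  dif_curv : forall A n (e : n = 2 + 1), cdg_dif e (cdg_curv A) = 0;
  dif_dif : forall A B n n' n'' (e : n' = n + 1) (e' : n'' = n' + 1)
      (e1 : n'' = 2 + n) (e2 : n'' = n + 2) (f : cdg_hom A B n),
    cdg_dif e' (cdg_dif e f) = cdg_comp e1 (cdg_curv B) f - cdg_comp e2 f (cdg_curv A)
}.

Arguments cdg_hom {k ob} c A B n.
Arguments cdg_comp {k ob} c {A B C m n p} e g f.
Arguments cdg_dif {k ob} c {A B n n'} e f.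
Arguments cdg_curv {k ob} c A.

Section CDGCategoryTheory.
Variables (k : comPzRingType) (ob : Type) (a : cdg_category k ob).

Definition is_identity A (u : cdg_hom a A A 0) : Prop :=
  (forall B n (e : n = 0 + n) (f : cdg_hom a B A n), cdg_comp a e u f = f) /\
  (forall B n (e : n = n + 0) (f : cdg_hom a A B n), cdg_comp a e f u = f).

Definition has_units : Prop := forall A, exists u : cdg_hom a A A 0, is_identity u.

(* The inverse [v] of a closed [u] is automatically closed. *)
Definition isomorphic A B : Prop :=
  exists (u : cdg_hom a A B 0) (v : cdg_hom a B A 0),
  [/\ cdg_dif a (esym (add0r 1)) u = 0,
      is_identity (cdg_comp a (esym (addr0 0)) v u) &
      is_identity (cdg_comp a (esym (addr0 0)) u v)].

Section Comp.
Variables (A B C : ob) (m n p : int) (e : p = m + n).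
Implicit Types (g : cdg_hom a B C m) (f : cdg_hom a A B n).

Lemma compDl g g' f : cdg_comp a e (g + g') f = cdg_comp a e g f + cdg_comp a e g' f.
Proof. by have := comp_linear_l e f 1 g g'; rewrite !scale1r. Qed.
Lemma compDr g f f' : cdg_comp a e g (f + f') = cdg_comp a e g f + cdg_comp a e g f'.
Proof. by have := comp_linear_r e g 1 f f'; rewrite !scale1r. Qed.
Lemma comp0l f : cdg_comp a e (0 : cdg_hom a B C m) f = 0.
Proof. by apply: (addIr (cdg_comp a e 0 f)); rewrite -compDl !add0r. Qed.
Lemma comp0r g : cdg_comp a e g (0 : cdg_hom a A B n) = 0.
Proof. by apply: (addIr (cdg_comp a e g 0)); rewrite -compDr !add0r. Qed.
Lemma compZl c g f : cdg_comp a e (c *: g) f = c *: cdg_comp a e g f.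
Proof. by have := comp_linear_l e f c g 0; rewrite comp0l !addr0. Qed.
Lemma compZr c g f : cdg_comp a e g (c *: f) = c *: cdg_comp a e g f.
Proof. by have := comp_linear_r e g c f 0; rewrite comp0r !addr0. Qed.
Lemma compNl g f : cdg_comp a e (- g) f = - cdg_comp a e g f.
Proof. by rewrite -!scaleN1r compZl. Qed.
Lemma compNr g f : cdg_comp a e g (- f) = - cdg_comp a e g f.
Proof. by rewrite -!scaleN1r compZr. Qed.
Lemma compBl g g' f : cdg_comp a e (g - g') f = cdg_comp a e g f - cdg_comp a e g' f.
Proof. by rewrite compDl compNl. Qed.
Lemma compBr g f f' : cdg_comp a e g (f - f') = cdg_comp a e g f - cdg_comp a e g f'.
Proof. by rewrite compDr compNr. Qed.
Lemma comp_suml I (s : seq I) (F : I -> cdg_hom a B C m) f :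
  cdg_comp a e (\sum_(i <- s) F i) f = \sum_(i <- s) cdg_comp a e (F i) f.
Proof.
by apply: (big_morph (fun g => cdg_comp a e g f)) => [g g'|];
  [exact: compDl | exact: comp0l].
Qed.
Lemma comp_sumr I (s : seq I) g (F : I -> cdg_hom a A B n) :
  cdg_comp a e g (\sum_(i <- s) F i) = \sum_(i <- s) cdg_comp a e g (F i).
Proof. by apply: big_morph => [f f'|]; [exact: compDr | exact: comp0r]. Qed.

End Comp.

Section Dif.
Variables (A B : ob) (n n' : int) (e : n' = n + 1).
Implicit Types (f g : cdg_hom a A B n).

Lemma difD f g : cdg_dif a e (f + g) = cdg_dif a e f + cdg_dif a e g.
Proof. by have := dif_linear e 1 f g; rewrite !scale1r. Qed.
Lemma dif0 : cdg_dif a e (0 : cdg_hom a A B n) = 0.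
Proof. by apply: (addIr (cdg_dif a e 0)); rewrite -difD !add0r. Qed.
Lemma difZ c f : cdg_dif a e (c *: f) = c *: cdg_dif a e f.
Proof. by have := dif_linear e c f 0; rewrite dif0 !addr0. Qed.
Lemma difN f : cdg_dif a e (- f) = - cdg_dif a e f.
Proof. by rewrite -!scaleN1r difZ. Qed.
Lemma difB f g : cdg_dif a e (f - g) = cdg_dif a e f - cdg_dif a e g.
Proof. by rewrite difD difN. Qed.
Lemma dif_sum I (s : seq I) (F : I -> cdg_hom a A B n) :
  cdg_dif a e (\sum_(i <- s) F i) = \sum_(i <- s) cdg_dif a e (F i).
Proof. by apply: big_morph => [f f'|]; [exact: difD | exact: dif0]. Qed.

End Dif.

(* Transport of a homogeneous element along an equality of degrees. *)
Definition dcast A B m n (e : m = n) (f : cdg_hom a A B m) : cdg_hom a A B n :=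
  ecast d (cdg_hom a A B d) e f.

Lemma dcast_id A B m (e : m = m) (f : cdg_hom a A B m) : dcast e f = f.
Proof. by rewrite (eq_irrelevance e erefl). Qed.
Lemma dcastD A B m n (e : m = n) (f g : cdg_hom a A B m) :
  dcast e (f + g) = dcast e f + dcast e g.
Proof. by case: _ / e. Qed.
Lemma dcast0 A B m n (e : m = n) : dcast e (0 : cdg_hom a A B m) = 0.
Proof. by case: _ / e. Qed.
Lemma dcastZ A B m n (e : m = n) c (f : cdg_hom a A B m) :
  dcast e (c *: f) = c *: dcast e f.
Proof. by case: _ / e. Qed.
Lemma comp_dcastl A B C m m' n p (em : m = m') (e : p = m' + n) (e' : p = m + n)
  (g : cdg_hom a B C m) (f : cdg_hom a A B n) :
  cdg_comp a e (dcast em g) f = cdg_comp a e' g f.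
Proof. by case: _ / em e => e; rewrite (eq_irrelevance e e'). Qed.
Lemma comp_dcastr A B C m n n' p (en : n = n') (e : p = m + n') (e' : p = m + n)
  (g : cdg_hom a B C m) (f : cdg_hom a A B n) :
  cdg_comp a e g (dcast en f) = cdg_comp a e' g f.
Proof. by case: _ / en e => e; rewrite (eq_irrelevance e e'). Qed.
Lemma dcast_comp A B C m n p p' (ep : p = p') (e : p = m + n) (e' : p' = m + n)
  (g : cdg_hom a B C m) (f : cdg_hom a A B n) :
  dcast ep (cdg_comp a e g f) = cdg_comp a e' g f.
Proof. by case: _ / ep e' => e'; rewrite (eq_irrelevance e e'). Qed.
Lemma dif_dcast A B m n n' (en : m = n) (e : n' = n + 1) (e' : n' = m + 1)
  (f : cdg_hom a A B m) : cdg_dif a e (dcast en f) = cdg_dif a e' f.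
Proof. by case: _ / en e => e; rewrite (eq_irrelevance e e'). Qed.
Lemma dcast_dif A B n m m' (em : m = m') (e : m = n + 1) (e' : m' = n + 1)
  (f : cdg_hom a A B n) : dcast em (cdg_dif a e f) = cdg_dif a e' f.
Proof. by case: _ / em e' => e'; rewrite (eq_irrelevance e e'). Qed.

End CDGCategoryTheory.

Record cdg_functor (k : comPzRingType) (obA obB : Type)
    (a : cdg_category k obA) (b : cdg_category k obB) : Type := CDGFunctor {
  fob : obA -> obB;
  fmap : forall A B n, cdg_hom a A B n -> cdg_hom b (fob A) (fob B) n;
  fmap_linear : forall A B n, linear (@fmap A B n);
  fmap_comp : forall A B C m n p (e : p = m + n)
      (g : cdg_hom a B C m) (f : cdg_hom a A B n),
    fmap (cdg_comp a e g f) = cdg_comp b e (fmap g) (fmap f);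
  fmap_dif : forall A B n n' (e : n' = n + 1) (f : cdg_hom a A B n),
    fmap (cdg_dif a e f) = cdg_dif b e (fmap f);
  fmap_curv : forall A, fmap (cdg_curv a A) = cdg_curv b (fob A)
}.

Arguments fob {k obA obB a b} c A.
Arguments fmap {k obA obB a b} c {A B n} f.

Section Functors.
Variables (k : comPzRingType) (obA obB obC : Type).
Variables (a : cdg_category k obA) (b : cdg_category k obB).
Variables (c : cdg_category k obC).

Fact fcomp_linear (G : cdg_functor b c) (F : cdg_functor a b) A B n :
  linear (fun f : cdg_hom a A B n => fmap G (fmap F f)).
Proof. by move=> r f g; rewrite !fmap_linear. Qed.
Fact fcomp_comp (G : cdg_functor b c) (F : cdg_functor a b)
    A B C m n p (e : p = m + n) (g : cdg_hom a B C m) (f : cdg_hom a A B n) :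
  fmap G (fmap F (cdg_comp a e g f)) =
  cdg_comp c e (fmap G (fmap F g)) (fmap G (fmap F f)).
Proof. by rewrite !fmap_comp. Qed.
Fact fcomp_dif (G : cdg_functor b c) (F : cdg_functor a b)
    A B n n' (e : n' = n + 1) (f : cdg_hom a A B n) :
  fmap G (fmap F (cdg_dif a e f)) = cdg_dif c e (fmap G (fmap F f)).
Proof. by rewrite !fmap_dif. Qed.
Fact fcomp_curv (G : cdg_functor b c) (F : cdg_functor a b) A :
  fmap G (fmap F (cdg_curv a A)) = cdg_curv c (fob G (fob F A)).
Proof. by rewrite !fmap_curv. Qed.

Definition fcomp (G : cdg_functor b c) (F : cdg_functor a b) : cdg_functor a c :=
  CDGFunctor (@fcomp_linear G F) (@fcomp_comp G F) (@fcomp_dif G F)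
    (@fcomp_curv G F).

Definition fully_faithful (F : cdg_functor a b) : Prop :=
  forall A B n, bijective (@fmap _ _ _ _ _ F A B n).

Definition in_essential_image (F : cdg_functor a b) (X : obB) : Prop :=
  exists A, isomorphic b (fob F A) X.

End Functors.

Section Free.
Variables (k : comPzRingType) (ob : Type) (a : cdg_category k ob).

(* The formal sum of the shifts Sigma^(fsh i) (fcomponent i), for i in fidx. *)
Record free_obj : Type := FreeObj {
  fidx : Type;
  fcomponent : fidx -> ob;
  fsh : fidx -> int
}.

(* Degree n part of Sigma^(fsh j - fsh i) of a graded Hom-module, where
   (Sigma V)^n = V^(n + 1). *)
Definition free_entry (M N : free_obj) (n : int) (i : fidx M) (j : fidx N) :
    lmodType k :=
  cdg_hom a (fcomponent i) (fcomponent j) (n + (fsh j - fsh i)).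

Definition free_hom (M N : free_obj) (n : int) : lmodType k :=
  lprod (fun i : fidx M => dsum (fun j : fidx N => free_entry n i j) : lmodType k).

Lemma free_homP M N n (f g : free_hom M N n) : (forall i j, f i j = g i j) -> f = g.
Proof.
by move=> fg; apply: functional_extensionality_dep => i; apply: dsumP => j.
Qed.

Fact free_comp_deg (m n p r s t : int) :
  p = m + n -> p + (t - r) = (m + (t - s)) + (n + (s - r)).
Proof. lia. Qed.
Fact free_dif_deg (n n' r s : int) : n' = n + 1 -> n' + (s - r) = n + (s - r) + 1.
Proof. lia. Qed.
Fact free_diag_deg (n r : int) : n = n + (r - r).
Proof. lia. Qed.

Section Comp.
Variables (L M N : free_obj) (m n p : int) (e : p = m + n).
Variables (g : free_hom M N m) (f : free_hom L M n).

(* Matrix multiplication; only finitely many [f i j] are nonzero.  No sign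
   occurs: on the level of shifted elements the shifts in the middle cancel,
   sigma^t g sigma^-s sigma^s f sigma^-r = sigma^t (g f) sigma^-r. *)
Definition free_comp_entry (i : fidx L) (l : fidx N) : free_entry p i l :=
  \sum_(j \in [set: {classic (fidx M)}])
    cdg_comp a (free_comp_deg (fsh i) (fsh j) (fsh l) e) (g j l) (f i j).

Lemma free_comp_entryE i l (s : seq {classic (fidx M)}) :
  uniq s -> (forall j : {classic (fidx M)}, j \notin s -> f i j = 0) ->
  free_comp_entry i l =
  \sum_(j <- s) cdg_comp a (free_comp_deg (fsh i) (fsh j) (fsh l) e) (g j l) (f i j).
Proof.
by move=> us s0; apply: fsum_seq => // j js; rewrite s0 // comp0r.
Qed.

Fact free_comp_fin i : finite_set [set l | free_comp_entry i l <> 0].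
Proof.
pose S := \bigcup_(j in [set j | f i j <> 0]) [set l | g j l <> 0].
apply: (@sub_finite_set _ _ S); last first.
  by apply: bigcup_finite => [|j _]; exact: dsum_fin.
move=> l /= nz; apply: contrapT => Sl; apply: nz; apply: fsbig1 => j _.
case: (pselect (f i j = 0)) => [->|fij]; first by rewrite comp0r.
case: (pselect (g j l = 0)) => [->|gjl]; first by rewrite comp0l.
by case: Sl; exists j.
Qed.

Definition free_comp : free_hom L N p := fun i => DSum (free_comp_fin i).

End Comp.

(* d (sigma^s f sigma^-r) = (-1)^s sigma^s (d f) sigma^-r. *)
Definition free_dif_entry M N n n' (e : n' = n + 1) (f : free_hom M N n)
    (i : fidx M) (j : fidx N) : free_entry n' i j :=
  ksgn k (fsh j) *: cdg_dif a (free_dif_deg (fsh i) (fsh j) e) (f i j).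

Fact free_dif_fin M N n n' (e : n' = n + 1) (f : free_hom M N n) i :
  finite_set [set j | free_dif_entry e f i j <> 0].
Proof.
apply: sub_finite_set (dsum_fin (f i)) => j /= nz fij.
by apply: nz; rewrite /free_dif_entry fij dif0 scaler0.
Qed.

Definition free_dif M N n n' (e : n' = n + 1) (f : free_hom M N n) :
    free_hom M N n' :=
  fun i => DSum (free_dif_fin e f i).

Definition free_diag M n (c : forall A, cdg_hom a A A n) : free_hom M M n :=
  fun i => dsum_in (V := fun j => free_entry n i j)
    (dcast (free_diag_deg n (fsh i)) (c (fcomponent i))).
Arguments free_diag M {n} c.

Lemma free_diag_compE L M m n p (e : p = m + n) (c : forall A, cdg_hom a A A m)
    (f : free_hom L M n) i j (e' : p + (fsh j - fsh i) = m + (n + (fsh j - fsh i))) :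
  free_comp e (free_diag M c) f i j = cdg_comp a e' (c (fcomponent j)) (f i j).
Proof.
rewrite /= /free_comp_entry (fsum_single (i0 := j)) => [|j' jj'].
  by rewrite dsum_in_id; exact: comp_dcastl.
by rewrite dsum_in_neq ?comp0l // => e''; apply: jj'.
Qed.

Lemma free_comp_diagE L M m n p (e : p = m + n) (c : forall A, cdg_hom a A A n)
    (f : free_hom L M m) i j (e' : p + (fsh j - fsh i) = m + (fsh j - fsh i) + n) :
  free_comp e f (free_diag L c) i j = cdg_comp a e' (f i j) (c (fcomponent i)).
Proof.
rewrite /= /free_comp_entry (fsum_single (i0 := i)) => [|i' ii'].
  by rewrite dsum_in_id; exact: comp_dcastr.
by rewrite dsum_in_neq ?comp0r.
Qed.

Fact free_comp_linear_l L M N m n p (e : p = m + n) (f : free_hom L M n) :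
  linear (fun g : free_hom M N m => free_comp e g f).
Proof.
move=> c g g'; apply: free_homP => i l.
have [s us s0] := dsum_supp (f i).
change (free_comp_entry e (c *: g + g') f i l =
        c *: free_comp_entry e g f i l + free_comp_entry e g' f i l).
rewrite !(free_comp_entryE e _ l us s0) scaler_sumr -big_split /=.
by apply: eq_bigr => j _; rewrite -comp_linear_l.
Qed.

Fact free_comp_linear_r L M N m n p (e : p = m + n) (g : free_hom M N m) :
  linear (fun f : free_hom L M n => free_comp e g f).
Proof.
move=> c f f'; apply: free_homP => i l.
have [s us s0] := dsum_supp (f i); have [s' us' s0'] := dsum_supp (f' i).
pose t := undup (s ++ s'); have ut : uniq t by exact: undup_uniq.
have t0 (j : {classic (fidx M)}) : j \notin t -> f i j = 0.
  by rewrite mem_undup mem_cat negb_or => /andP[/s0].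
have t0' (j : {classic (fidx M)}) : j \notin t -> f' i j = 0.
  by rewrite mem_undup mem_cat negb_or => /andP[_ /s0'].
have t0'' (j : {classic (fidx M)}) : j \notin t -> (c *: f + f') i j = 0.
  move=> jt; change (c *: f i j + f' i j = 0).
  by rewrite t0 // t0' // scaler0 addr0.
change (free_comp_entry e g (c *: f + f') i l =
        c *: free_comp_entry e g f i l + free_comp_entry e g f' i l).
rewrite (free_comp_entryE e _ l ut t0) (free_comp_entryE e _ l ut t0').
rewrite (free_comp_entryE e _ l ut t0'') scaler_sumr -big_split /=.
by apply: eq_bigr => j _; rewrite -comp_linear_r.
Qed.

Fact free_compA K L M N l m n lm mn lmn (e1 : mn = m + n) (e2 : lmn = l + mn)
    (e3 : lm = l + m) (e4 : lmn = lm + n)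
    (h : free_hom M N l) (g : free_hom L M m) (f : free_hom K L n) :
  free_comp e2 h (free_comp e1 g f) = free_comp e4 (free_comp e3 h g) f.
Proof.
apply: free_homP => i q.
have [s us s0] := dsum_supp (f i).
have /finite_fsetP [T0 T0E] : finite_set
    (\bigcup_(j in [set j : {classic (fidx L)} | f i j <> 0])
       [set r : {classic (fidx M)} | g j r <> 0]).
  by apply: bigcup_finite => [|j _]; exact: dsum_fin.
pose t : seq {classic (fidx M)} := T0.
have ut : uniq t by exact: fset_uniq.
have t0 j (r : {classic (fidx M)}) : r \notin t -> f i j = 0 \/ g j r = 0.
  move=> rt; case: (pselect (f i j = 0)) => [|fij]; [by left | right].
  apply: contrapT => gjr; move/negP: rt; apply.
  suff : [set` T0] r by [].
  by rewrite -T0E; exists j.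
have t1 (r : {classic (fidx M)}) : r \notin t -> free_comp e1 g f i r = 0.
  move=> rt; apply: fsbig1 => j _.
  by have [->|->] := t0 j r rt; rewrite ?comp0r ?comp0l.
have t2 j (r : {classic (fidx M)}) : f i j <> 0 -> r \notin t -> g j r = 0.
  by move=> fij rt; have [|] := t0 j r rt.
change (free_comp_entry e2 h (free_comp e1 g f) i q =
        free_comp_entry e4 (free_comp e3 h g) f i q).
rewrite (free_comp_entryE e2 _ q ut t1) (free_comp_entryE e4 _ q us s0).
under eq_bigr => r _.
  change (free_comp e1 g f i r) with (free_comp_entry e1 g f i r).
  rewrite (free_comp_entryE e1 _ r us s0) comp_sumr; over.
rewrite exchange_big /=; apply: eq_bigr => j _.
case: (pselect (f i j = 0)) => [->|fij].
  by rewrite comp0r big1 // => r _; rewrite !comp0r.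
rewrite (free_comp_entryE e3 h q ut (fun r => t2 j r fij)) comp_suml.
apply: eq_bigr => r _; exact: compA.
Qed.

Fact free_dif_linear M N n n' (e : n' = n + 1) : linear (@free_dif M N n n' e).
Proof.
move=> c f g; apply: free_homP => i j.
change (free_dif_entry e (c *: f + g) i j =
        c *: free_dif_entry e f i j + free_dif_entry e g i j).
rewrite /free_dif_entry.
change ((c *: f + g) i j) with (c *: f i j + g i j).
by rewrite difD difZ scalerDr !scalerA mulrC.
Qed.

Fact free_dif_comp L M N m n p m' n' p' (e : p = m + n) (ep : p' = p + 1)
    (em : m' = m + 1) (e1 : p' = m' + n) (en : n' = n + 1) (e2 : p' = m + n')
    (g : free_hom M N m) (f : free_hom L M n) :
  free_dif ep (free_comp e g f) =
    free_comp e1 (free_dif em g) f + ksgn k m *: free_comp e2 g (free_dif en f).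
Proof.
apply: free_homP => i l.
have [s us s0] := dsum_supp (f i).
have s1 (j : {classic (fidx M)}) : j \notin s -> free_dif en f i j = 0.
  move=> js; change (free_dif_entry en f i j = 0).
  by rewrite /free_dif_entry s0 // dif0 scaler0.
change (free_dif_entry ep (free_comp e g f) i l =
  free_comp_entry e1 (free_dif em g) f i l
  + ksgn k m *: free_comp_entry e2 g (free_dif en f) i l).
rewrite /free_dif_entry.
change (free_comp e g f i l) with (free_comp_entry e g f i l).
rewrite (free_comp_entryE e _ l us s0) (free_comp_entryE e1 _ l us s0).
rewrite (free_comp_entryE e2 _ l us s1) dif_sum !scaler_sumr -big_split /=.
apply: eq_bigr => j _.
rewrite (dif_comp _ _ (free_dif_deg _ _ em) (free_comp_deg _ _ _ e1)
  (free_dif_deg _ _ en) (free_comp_deg _ _ _ e2)) scalerDr.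
congr (_ + _); first by rewrite compZl.
rewrite compZr !scalerA ksgnD ksgnB; congr (_ *: _).
by rewrite mulrCA [X in _ * X]mulrA ksgnM mul1r.
Qed.

Fact free_dif_curv M n (e : n = 2 + 1) : free_dif e (free_diag M (cdg_curv a)) = 0.
Proof.
apply: free_homP => i j.
change (ksgn k (fsh j) *:
  cdg_dif a (free_dif_deg (fsh i) (fsh j) e) (free_diag M (cdg_curv a) i j) = 0).
case: (pselect (i = j)) => [ij|ij]; last by rewrite dsum_in_neq // dif0 scaler0.
case: _ / ij; rewrite dsum_in_id.
have e' : n + (fsh i - fsh i) = 2 + 1 by lia.
by rewrite (dif_dcast _ _ e') dif_curv scaler0.
Qed.

Fact free_dif_dif M N n n' n'' (e : n' = n + 1) (e' : n'' = n' + 1)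
    (e1 : n'' = 2 + n) (e2 : n'' = n + 2) (f : free_hom M N n) :
  free_dif e' (free_dif e f) =
    free_comp e1 (free_diag N (cdg_curv a)) f - free_comp e2 f (free_diag M (cdg_curv a)).
Proof.
apply: free_homP => i j.
change (ksgn k (fsh j) *: cdg_dif a (free_dif_deg (fsh i) (fsh j) e')
          (ksgn k (fsh j) *: cdg_dif a (free_dif_deg (fsh i) (fsh j) e) (f i j)) =
  free_comp e1 (free_diag N (cdg_curv a)) f i j
  - free_comp e2 f (free_diag M (cdg_curv a)) i j).
have e1' : n'' + (fsh j - fsh i) = 2 + (n + (fsh j - fsh i)) by lia.
have e2' : n'' + (fsh j - fsh i) = n + (fsh j - fsh i) + 2 by lia.
by rewrite (free_diag_compE _ _ _ e1') (free_comp_diagE _ _ _ e2') difZ ksgnK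
  (dif_dif _ _ e1' e2').
Qed.

Definition free_cdg : cdg_category k free_obj :=
  CDGCategory free_comp_linear_l free_comp_linear_r free_compA free_dif_linear
    free_dif_comp free_dif_curv free_dif_dif.

End Free.

Arguments free_diag {k ob a} M {n} c.

Section Con.
Variables (k : comPzRingType) (ob : Type) (b : cdg_category k ob).

(* [con_cdg (free_cdg a)] is Free(a)_con; the same twisting makes sense over any
   cdg-category. *)
Record con_obj : Type := ConObj {
  con_ob : ob;
  con_delta : cdg_hom b con_ob con_ob 1
}.

Definition con_hom (M N : con_obj) (n : int) : lmodType k :=
  cdg_hom b (con_ob M) (con_ob N) n.

Definition con_comp (L M N : con_obj) m n p (e : p = m + n)
    (g : con_hom M N m) (f : con_hom L M n) : con_hom L N p :=
  cdg_comp b e g f.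

Fact con_deg (n n' : int) : n' = n + 1 -> n' = 1 + n.
Proof. by rewrite addrC. Qed.
Fact con_deg2 : 2 = 1 + 1 :> int.
Proof. by []. Qed.

Definition con_dif (M N : con_obj) n n' (e : n' = n + 1) (f : con_hom M N n) :
    con_hom M N n' :=
  cdg_dif b e f + cdg_comp b (con_deg e) (con_delta N) f
  - ksgn k n *: cdg_comp b e f (con_delta M).

Definition con_curv (M : con_obj) : con_hom M M 2 :=
  cdg_curv b (con_ob M) + cdg_dif b con_deg2 (con_delta M)
  + cdg_comp b con_deg2 (con_delta M) (con_delta M).

Fact con_comp_linear_l L M N m n p (e : p = m + n) (f : con_hom L M n) :
  linear (fun g : con_hom M N m => con_comp e g f).
Proof. exact: comp_linear_l. Qed.

Fact con_comp_linear_r L M N m n p (e : p = m + n) (g : con_hom M N m) :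
  linear (fun f : con_hom L M n => con_comp e g f).
Proof. exact: comp_linear_r. Qed.

Fact con_compA K L M N l m n lm mn lmn (e1 : mn = m + n) (e2 : lmn = l + mn)
    (e3 : lm = l + m) (e4 : lmn = lm + n)
    (h : con_hom M N l) (g : con_hom L M m) (f : con_hom K L n) :
  con_comp e2 h (con_comp e1 g f) = con_comp e4 (con_comp e3 h g) f.
Proof. exact: compA. Qed.

Fact con_dif_linear M N n n' (e : n' = n + 1) : linear (@con_dif M N n n' e).
Proof.
move=> c f g; rewrite /con_dif dif_linear comp_linear_r comp_linear_l.
rewrite !scalerDr scalerN !scalerA [ksgn k n * c]mulrC -!scalerA opprD.
by rewrite [_ + (c *: _ + _)]addrACA [LHS]addrACA.
Qed.

Fact con_dif_comp L M N m n p m' n' p' (e : p = m + n) (ep : p' = p + 1)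
    (em : m' = m + 1) (e1 : p' = m' + n) (en : n' = n + 1) (e2 : p' = m + n')
    (g : con_hom M N m) (f : con_hom L M n) :
  con_dif ep (con_comp e g f) =
    con_comp e1 (con_dif em g) f + ksgn k m *: con_comp e2 g (con_dif en f).
Proof.
rewrite /con_dif /con_comp (dif_comp _ _ em e1 en e2).
rewrite !(compDl, compDr, compNl, compNr, compZl, compZr).
rewrite (compA _ _ (con_deg em) e1) -(compA en e2 e ep).
rewrite (compA (con_deg en) e2 em e1).
rewrite !scalerDr !scalerN !scalerA -ksgnD -e.
set x1 := cdg_comp b _ (cdg_dif b _ g) f; set x2 := cdg_comp b _ (cdg_comp b _ (con_delta N) g) f.
set x3 := _ *: cdg_comp b _ (cdg_comp b _ g (con_delta M)) f.
set x4 := _ *: cdg_comp b _ g (cdg_dif b _ f); set x5 := _ *: cdg_comp b _ g (cdg_comp b _ f _).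
by rewrite [x4 + x3]addrC -[x3 + x4 - x5]addrA subrKA [x1 + x4 + x2]addrAC !addrA.
Qed.

Fact con_dif_curv M n (e : n = 2 + 1) : con_dif e (con_curv M) = 0.
Proof.
rewrite /con_dif /con_curv; set d := con_delta M.
have e3 : n = 1 + 2 by rewrite e.
rewrite !(compDl, compDr, difD) dif_curv add0r.
rewrite (dif_dif _ _ e e3) (dif_comp _ e con_deg2 e con_deg2 e3) ksgn1 scaleN1r.
rewrite -(compA con_deg2 e3) (_ : ksgn k 2 = 1) ?scale1r; last first.
  by rewrite /ksgn expr2 mulrNN mulr1.
rewrite (eq_irrelevance (con_deg e) e3).
set x1 := cdg_comp b _ (cdg_curv b _) d; set x2 := cdg_comp b _ d (cdg_curv b _).
set x3 := cdg_comp b _ (cdg_dif b _ d) d; set x4 := cdg_comp b _ d (cdg_dif b _ d).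
set x5 := cdg_comp b _ d (cdg_comp b _ d d).
apply/eqP; rewrite subr_eq0; apply/eqP.
by rewrite [_ + (x3 - x4)]addrACA -opprD subrKA.
Qed.

Fact con_dif_dif M N n n' n'' (e : n' = n + 1) (e' : n'' = n' + 1)
    (e1 : n'' = 2 + n) (e2 : n'' = n + 2) (f : con_hom M N n) :
  con_dif e' (con_dif e f) =
    con_comp e1 (con_curv N) f - con_comp e2 f (con_curv M).
Proof.
rewrite /con_dif /con_comp /con_curv; set d := con_delta M; set d' := con_delta N.
have en' : ksgn k n' = - ksgn k n by rewrite e ksgnS.
rewrite en' scaleNr opprK.
rewrite !(compDl, compDr, compNl, compNr, compZl, compZr, difD, difN, difZ).
rewrite (dif_dif _ _ e1 e2).
rewrite (dif_comp (con_deg e) e' con_deg2 e1 e (con_deg e')).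
rewrite (dif_comp e e' e e' con_deg2 e2) ksgn1 scaleN1r.
rewrite (compA (con_deg e) (con_deg e') con_deg2 e1).
rewrite (compA e (con_deg e') (con_deg e) e').
rewrite -(compA con_deg2 e2 e e').
rewrite !scalerDr !scalerN !ksgnK.
set x1 := cdg_comp b _ (cdg_curv b _) f; set x2 := cdg_comp b _ f (cdg_curv b _).
set x3 := cdg_comp b _ (cdg_dif b _ d') f; set x4 := cdg_comp b _ d' (cdg_dif b _ f).
set x5 := ksgn k n *: cdg_comp b _ (cdg_dif b _ f) d; set x6 := cdg_comp b _ f (cdg_dif b _ d).
set x7 := cdg_comp b _ (cdg_comp b _ d' d') f.
set x8 := ksgn k n *: cdg_comp b _ (cdg_comp b _ d' f) d; set x9 := cdg_comp b _ f (cdg_comp b _ d d).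
rewrite -[LHS]addrA [x4 + x7 - x8 + _]addrACA [x1 - x2 + _]addrACA -!opprD.
rewrite -[x1 + x3 - _ - _]addrA -opprD [LHS]addrACA -opprD.
rewrite [x1 + x3 + (x4 + x7 + _)](AC (2*(2*2)) ((1*2*4)*(3*5*6))).
rewrite [x2 + x4 + (x5 + x6) + _](AC (2*2*2) ((1*4*6)*(2*3*5))).
by rewrite opprD addrACA subrr addr0.
Qed.

Definition con_cdg : cdg_category k con_obj :=
  CDGCategory con_comp_linear_l con_comp_linear_r con_compA con_dif_linear
    con_dif_comp con_dif_curv con_dif_dif.

End Con.

Section Modules.
Variables (k : comPzRingType) (ob : Type) (a : cdg_category k ob).

(* Right modules.  When identities exist, they are not required to act as
   identities. *)
Record gmodule : Type := GModule {
  gcar :> ob -> int -> lmodType k;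
  gact : forall A B (m n p : int), p = m + n -> gcar B m -> cdg_hom a A B n -> gcar A p;
  gact_linear_l : forall A B m n p (e : p = m + n) (f : cdg_hom a A B n),
    linear (fun x : gcar B m => gact e x f);
  gact_linear_r : forall A B m n p (e : p = m + n) (x : gcar B m),
    linear (fun f : cdg_hom a A B n => gact e x f);
  gactA : forall A B C l m n lm mn lmn (e1 : mn = m + n) (e2 : lmn = l + mn)
      (e3 : lm = l + m) (e4 : lmn = lm + n)
      (x : gcar C l) (g : cdg_hom a B C m) (f : cdg_hom a A B n),
    gact e2 x (cdg_comp a e1 g f) = gact e4 (gact e3 x g) f
}.
Arguments gact M {A B m n p} e x f : rename.

Section Action.
Variables (M : gmodule) (A B : ob) (m n p : int) (e : p = m + n).
Implicit Types (x : M B m) (f : cdg_hom a A B n).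

Lemma gactDl x y f : gact M e (x + y) f = gact M e x f + gact M e y f.
Proof. by have := gact_linear_l e f 1 x y; rewrite !scale1r. Qed.
Lemma gactDr x f g : gact M e x (f + g) = gact M e x f + gact M e x g.
Proof. by have := gact_linear_r e x 1 f g; rewrite !scale1r. Qed.
Lemma gact0l f : gact M e (0 : M B m) f = 0.
Proof. by apply: (addIr (gact M e 0 f)); rewrite -gactDl !add0r. Qed.
Lemma gact0r x : gact M e x (0 : cdg_hom a A B n) = 0.
Proof. by apply: (addIr (gact M e x 0)); rewrite -gactDr !add0r. Qed.
Lemma gactZl c x f : gact M e (c *: x) f = c *: gact M e x f.
Proof. by have := gact_linear_l e f c x 0; rewrite gact0l !addr0. Qed.
Lemma gactZr c x f : gact M e x (c *: f) = c *: gact M e x f.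
Proof. by have := gact_linear_r e x c f 0; rewrite gact0r !addr0. Qed.
Lemma gactNl x f : gact M e (- x) f = - gact M e x f.
Proof. by rewrite -!scaleN1r gactZl. Qed.
Lemma gactNr x f : gact M e x (- f) = - gact M e x f.
Proof. by rewrite -!scaleN1r gactZr. Qed.
End Action.

Record gnat (M N : gmodule) (n : int) : Type := GNat {
  gnat_val :> forall A (p q : int), q = n + p -> M A p -> N A q;
  gnat_linear : forall A p q (e : q = n + p), linear (@gnat_val A p q e);
  gnat_act : forall A B p q r s t (e : q = n + p) (er : r = p + s)
      (e1 : t = n + r) (e2 : t = q + s) (x : M B p) (f : cdg_hom a A B s),
    gnat_val e1 (gact M er x f) = gact N e2 (gnat_val e x) f
}.

Section GNatModule.
Variables (M N : gmodule) (n : int).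
Implicit Types (u v w : gnat M N n).

Lemma gnatP u v :
  (forall A p q (e : q = n + p) (x : M A p), u A p q e x = v A p q e x) -> u = v.
Proof.
case: u v => [u u1 u2] [v v1 v2] /= uv.
have {}uv : u = v.
  by do 5! apply: functional_extensionality_dep => ?.
case: _ / uv v1 v2 => v1 v2.
by rewrite (Prop_irrelevance u1 v1) (Prop_irrelevance u2 v2).
Qed.

Section Apply.
Variables (u : gnat M N n) (A : ob) (p q : int) (e : q = n + p).
Implicit Types (x y : M A p).
Lemma gnatD x y : u A p q e (x + y) = u A p q e x + u A p q e y.
Proof. by have := gnat_linear u e 1 x y; rewrite !scale1r. Qed.
Lemma gnat0 : u A p q e (0 : M A p) = 0.
Proof. by apply: (addIr (u A p q e 0)); rewrite -gnatD !add0r. Qed.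
Lemma gnatZ c x : u A p q e (c *: x) = c *: u A p q e x.
Proof. by have := gnat_linear u e c x 0; rewrite gnat0 !addr0. Qed.
Lemma gnatN x : u A p q e (- x) = - u A p q e x.
Proof. by rewrite -!scaleN1r gnatZ. Qed.
End Apply.

Fact gnat_add_linear u v A p q (e : q = n + p) :
  linear (fun x : M A p => u A p q e x + v A p q e x).
Proof. by move=> c x y; rewrite !gnat_linear scalerDr addrACA. Qed.
Fact gnat_add_act u v A B p q r s t (e : q = n + p) (er : r = p + s)
    (e1 : t = n + r) (e2 : t = q + s) (x : M B p) (f : cdg_hom a A B s) :
  u A r t e1 (gact M er x f) + v A r t e1 (gact M er x f) =
  gact N e2 (u B p q e x + v B p q e x) f.
Proof. by rewrite gactDl !(gnat_act _ e er e1 e2). Qed.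
Definition gnat_add u v : gnat M N n := GNat (gnat_add_linear u v) (gnat_add_act u v).

Fact gnat_zero_linear A p q (e : q = n + p) : linear (fun _ : M A p => 0 : N A q).
Proof. by move=> c x y; rewrite scaler0 addr0. Qed.
Fact gnat_zero_act A B p q r s t (e : q = n + p) (er : r = p + s)
    (e1 : t = n + r) (e2 : t = q + s) (x : M B p) (f : cdg_hom a A B s) :
  0 = gact N e2 (0 : N B q) f.
Proof. by rewrite gact0l. Qed.
Definition gnat_zero : gnat M N n := GNat gnat_zero_linear gnat_zero_act.

Fact gnat_scale_linear (d : k) u A p q (e : q = n + p) :
  linear (fun x : M A p => d *: u A p q e x).
Proof. by move=> c x y; rewrite gnat_linear scalerDr !scalerA mulrC. Qed.
Fact gnat_scale_act (d : k) u A B p q r s t (e : q = n + p) (er : r = p + s)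
    (e1 : t = n + r) (e2 : t = q + s) (x : M B p) (f : cdg_hom a A B s) :
  d *: u A r t e1 (gact M er x f) = gact N e2 (d *: u B p q e x) f.
Proof. by rewrite gactZl (gnat_act _ e er e1 e2). Qed.
Definition gnat_scale (d : k) u : gnat M N n :=
  GNat (gnat_scale_linear d u) (gnat_scale_act d u).

Definition gnat_opp u : gnat M N n := gnat_scale (-1) u.

Fact gnat_addA : associative gnat_add.
Proof. by move=> u v w; apply: gnatP => *; exact: addrA. Qed.
Fact gnat_addC : commutative gnat_add.
Proof. by move=> u v; apply: gnatP => *; exact: addrC. Qed.
Fact gnat_add0 : left_id gnat_zero gnat_add.
Proof. by move=> u; apply: gnatP => *; exact: add0r. Qed.
Fact gnat_addN : left_inverse gnat_zero gnat_opp gnat_add.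
Proof. by move=> u; apply: gnatP => * /=; rewrite scaleN1r addNr. Qed.

HB.instance Definition _ := gen_eqMixin (gnat M N n).
HB.instance Definition _ := gen_choiceMixin (gnat M N n).
HB.instance Definition _ :=
  GRing.isZmodule.Build (gnat M N n) gnat_addA gnat_addC gnat_add0 gnat_addN.

Fact gnat_scaleA c d u : gnat_scale c (gnat_scale d u) = gnat_scale (c * d) u.
Proof. by apply: gnatP => *; exact: scalerA. Qed.
Fact gnat_scale1 : left_id 1 gnat_scale.
Proof. by move=> u; apply: gnatP => *; exact: scale1r. Qed.
Fact gnat_scaleDr : right_distributive gnat_scale +%R.
Proof. by move=> c u v; apply: gnatP => *; exact: scalerDr. Qed.
Fact gnat_scaleDl u : {morph gnat_scale^~ u : c d / c + d}.
Proof. by move=> c d; apply: gnatP => *; exact: scalerDl. Qed.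

HB.instance Definition _ :=
  GRing.Zmodule_isLmodule.Build k (gnat M N n) gnat_scaleA gnat_scale1
    gnat_scaleDr gnat_scaleDl.

Lemma gnat_addE u v A p q (e : q = n + p) x :
  (u + v) A p q e x = u A p q e x + v A p q e x.
Proof. by []. Qed.
Lemma gnat_scaleE (d : k) u A p q (e : q = n + p) x :
  (d *: u) A p q e x = d *: u A p q e x.
Proof. by []. Qed.
Lemma gnat_oppE u A p q (e : q = n + p) x : (- u) A p q e x = - u A p q e x.
Proof. exact: scaleN1r. Qed.

End GNatModule.

Section GNatId.
Variable M : gmodule.

Definition gnat_id_val A (p q : int) (e : q = 0 + p) (x : M A p) : M A q :=
  ecast d (M A d) (etrans (esym (add0r p)) (esym e)) x.

Lemma gnat_id_valE A p (e : p = 0 + p) (x : M A p) : gnat_id_val e x = x.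
Proof. by rewrite /gnat_id_val (eq_irrelevance (etrans _ _) erefl). Qed.

Fact gnat_id_linear A p q (e : q = 0 + p) : linear (@gnat_id_val A p q e).
Proof.
have eq : q = p by rewrite e add0r.
by case: _ / eq e => e c x y; rewrite !gnat_id_valE.
Qed.
Fact gnat_id_act A B p q r s t (e : q = 0 + p) (er : r = p + s)
    (e1 : t = 0 + r) (e2 : t = q + s) (x : M B p) (f : cdg_hom a A B s) :
  gnat_id_val e1 (gact M er x f) = gact M e2 (gnat_id_val e x) f.
Proof.
have eq : p = q by rewrite e add0r.
have et : r = t by rewrite e1 add0r.
case: _ / eq e e2 => e e2; case: _ / et e1 e2 => e1 e2.
by rewrite !gnat_id_valE (eq_irrelevance er e2).
Qed.
Definition gnat_id : gnat M M 0 := GNat gnat_id_linear gnat_id_act.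

End GNatId.

Section GNatComp.
Variables (L M N : gmodule) (m n p : int) (e : p = m + n).
Variables (v : gnat M N m) (u : gnat L M n).

Fact gnat_comp_deg (q r : int) : r = p + q -> r = m + (n + q).
Proof. by rewrite e addrA. Qed.

Definition gnat_comp_val A q r (er : r = p + q) (x : L A q) : N A r :=
  v A (n + q) r (gnat_comp_deg er) (u A q (n + q) erefl x).

Fact gnat_comp_linear A q r (er : r = p + q) : linear (@gnat_comp_val A q r er).
Proof. by move=> c x y; rewrite /gnat_comp_val !gnat_linear. Qed.
Fact gnat_comp_act A B q r s t w (er : r = p + q) (es : s = q + t)
    (e1 : w = p + s) (e2 : w = r + t) (x : L B q) (f : cdg_hom a A B t) :
  gnat_comp_val e1 (gact L es x f) = gact N e2 (gnat_comp_val er x) f.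
Proof.
have es' : n + s = n + q + t by rewrite es addrA.
rewrite /gnat_comp_val (gnat_act u erefl es erefl es').
exact: gnat_act.
Qed.
Definition gnat_comp : gnat L N p := GNat gnat_comp_linear gnat_comp_act.

Lemma gnat_compE A q r s (er : r = p + q) (es : s = n + q) (er' : r = m + s)
  (x : L A q) : gnat_comp A q r er x = v A s r er' (u A q s es x).
Proof. by subst s; rewrite (eq_irrelevance er' (gnat_comp_deg er)). Qed.

End GNatComp.
Arguments gnat_compE {L M N m n p} e v u {A q r s} er es er' x.

Definition gmod_isomorphic (M N : gmodule) : Prop :=
  exists (u : gnat M N 0) (v : gnat N M 0),
    gnat_comp (esym (addr0 0)) v u = gnat_id M /\
    gnat_comp (esym (addr0 0)) u v = gnat_id N.

Definition gmod_repr (A : ob) : gmodule :=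
  @GModule (fun B n => cdg_hom a B A n) (fun B C m n p e x f => cdg_comp a e x f)
    (fun B C m n p e f => comp_linear_l e f)
    (fun B C m n p e x => comp_linear_r e x)
    (fun B C D l m n lm mn lmn e1 e2 e3 e4 x g f => compA e1 e2 e3 e4 x g f).

Section Shift.
Variables (s : int) (M : gmodule).

Fact gmod_shift_deg (m n p : int) : p = m + n -> p + s = m + s + n.
Proof. by move=> ->; rewrite addrAC. Qed.

(* The scalars act on the right, so shifting introduces no sign. *)
Definition gmod_shift_act A B m n p (e : p = m + n) (x : M B (m + s))
    (f : cdg_hom a A B n) : M A (p + s) :=
  gact M (gmod_shift_deg e) x f.

Fact gmod_shift_linear_l A B m n p (e : p = m + n) (f : cdg_hom a A B n) :
  linear (fun x : M B (m + s) => gmod_shift_act e x f).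
Proof. exact: gact_linear_l. Qed.
Fact gmod_shift_linear_r A B m n p (e : p = m + n) (x : M B (m + s)) :
  linear (fun f : cdg_hom a A B n => gmod_shift_act e x f).
Proof. exact: gact_linear_r. Qed.
Fact gmod_shift_actA A B C l m n lm mn lmn (e1 : mn = m + n) (e2 : lmn = l + mn)
    (e3 : lm = l + m) (e4 : lmn = lm + n)
    (x : M C (l + s)) (g : cdg_hom a B C m) (f : cdg_hom a A B n) :
  gmod_shift_act e2 x (cdg_comp a e1 g f) =
  gmod_shift_act e4 (gmod_shift_act e3 x g) f.
Proof. exact: gactA. Qed.

Definition gmod_shift : gmodule :=
  @GModule (fun A n => M A (n + s)) gmod_shift_act
    gmod_shift_linear_l gmod_shift_linear_r gmod_shift_actA.

End Shift.

Section GModSum.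
Variables (I : Type) (M : I -> gmodule).

Fact gmod_dsum_act_fin A B m n p (e : p = m + n) (x : dsum (fun i => M i B m))
    (f : cdg_hom a A B n) : finite_set [set i | gact (M i) e (x i) f <> 0].
Proof.
apply: sub_finite_set (dsum_fin x) => i /= nz xi0.
by apply: nz; rewrite xi0 gact0l.
Qed.
Definition gmod_dsum_act A B m n p (e : p = m + n) (x : dsum (fun i => M i B m))
    (f : cdg_hom a A B n) : dsum (fun i => M i A p) :=
  DSum (gmod_dsum_act_fin e x f).

Fact gmod_dsum_linear_l A B m n p (e : p = m + n) (f : cdg_hom a A B n) :
  linear (fun x : dsum (fun i => M i B m) => gmod_dsum_act e x f).
Proof. by move=> c x y; apply: dsumP => i; exact: gact_linear_l. Qed.
Fact gmod_dsum_linear_r A B m n p (e : p = m + n) (x : dsum (fun i => M i B m)) :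
  linear (fun f : cdg_hom a A B n => gmod_dsum_act e x f).
Proof. by move=> c f g; apply: dsumP => i; exact: gact_linear_r. Qed.
Fact gmod_dsum_actA A B C l m n lm mn lmn (e1 : mn = m + n) (e2 : lmn = l + mn)
    (e3 : lm = l + m) (e4 : lmn = lm + n)
    (x : dsum (fun i => M i C l)) (g : cdg_hom a B C m) (f : cdg_hom a A B n) :
  gmod_dsum_act e2 x (cdg_comp a e1 g f) = gmod_dsum_act e4 (gmod_dsum_act e3 x g) f.
Proof. by apply: dsumP => i; exact: gactA. Qed.

Definition gmod_dsum : gmodule :=
  @GModule (fun A n => dsum (fun i => M i A n) : lmodType k) gmod_dsum_act
    gmod_dsum_linear_l gmod_dsum_linear_r gmod_dsum_actA.

End GModSum.

Record qdg_module : Type := QDGModule {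
  qdg_graded :> gmodule;
  mdif : forall A (n n' : int), n' = n + 1 -> qdg_graded A n -> qdg_graded A n';
  mdif_linear : forall A n n' (e : n' = n + 1), linear (@mdif A n n' e);
  mdif_act : forall A B m n p m' n' p' (e : p = m + n) (ep : p' = p + 1)
      (em : m' = m + 1) (e1 : p' = m' + n) (en : n' = n + 1) (e2 : p' = m + n')
      (x : qdg_graded B m) (f : cdg_hom a A B n),
    mdif ep (gact qdg_graded e x f) =
      gact qdg_graded e1 (mdif em x) f
      + ksgn k m *: gact qdg_graded e2 x (cdg_dif a en f)
}.
Arguments mdif M {A n n'} e x : rename.

Definition graded_free (M : qdg_module) : Prop :=
  exists (I : Type) (A : I -> ob) (s : I -> int),
    gmod_isomorphic M (gmod_dsum (fun i => gmod_shift (s i) (gmod_repr (A i)))).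

Section MDif.
Variables (M : qdg_module) (A : ob) (n n' : int) (e : n' = n + 1).
Implicit Types (x y : M A n).
Lemma mdifD x y : mdif M e (x + y) = mdif M e x + mdif M e y.
Proof. by have := mdif_linear e 1 x y; rewrite !scale1r. Qed.
Lemma mdif0 : mdif M e (0 : M A n) = 0.
Proof. by apply: (addIr (mdif M e 0)); rewrite -mdifD !add0r. Qed.
Lemma mdifZ c x : mdif M e (c *: x) = c *: mdif M e x.
Proof. by have := mdif_linear e c x 0; rewrite mdif0 !addr0. Qed.
Lemma mdifN x : mdif M e (- x) = - mdif M e x.
Proof. by rewrite -!scaleN1r mdifZ. Qed.
End MDif.

Definition qdg_hom (M N : qdg_module) (n : int) : lmodType k := gnat M N n.

Section QDGDif.
Variables (M N : qdg_module) (n n' : int) (e : n' = n + 1) (u : qdg_hom M N n).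

Fact qdg_dif_deg1 (p q : int) : q = n' + p -> q = n + p + 1.
Proof. by rewrite e addrAC. Qed.
Fact qdg_dif_deg2 (p q : int) : q = n' + p -> q = n + (p + 1).
Proof. by rewrite e -addrA [1 + p]addrC. Qed.

Definition qdg_dif_val A p q (eq : q = n' + p) (x : M A p) : N A q :=
  mdif N (qdg_dif_deg1 eq) (u A p (n + p) erefl x)
  - ksgn k n *: u A (p + 1) q (qdg_dif_deg2 eq) (mdif M erefl x).

Fact qdg_dif_linear_val A p q (eq : q = n' + p) : linear (@qdg_dif_val A p q eq).
Proof.
move=> c x y; rewrite /qdg_dif_val !(gnat_linear, mdif_linear).
rewrite scalerDr opprD addrACA scalerBr; congr (_ - _ + _).
by rewrite !scalerA mulrC.
Qed.

Fact qdg_dif_act A B p q r s t (eq : q = n' + p) (er : r = p + s)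
    (e1 : t = n' + r) (e2 : t = q + s) (x : M B p) (f : cdg_hom a A B s) :
  qdg_dif_val e1 (gact M er x f) = gact N e2 (qdg_dif_val eq x) f.
Proof.
have e3 : n + r = n + p + s by rewrite er addrA.
have e4 : t = n + p + (s + 1) by rewrite e2 eq e; lia.
have e5 : r + 1 = p + 1 + s by rewrite er addrAC.
have e6 : r + 1 = p + (s + 1) by rewrite er addrA.
rewrite /qdg_dif_val (gnat_act u erefl er erefl e3).
rewrite (mdif_act e3 _ (qdg_dif_deg1 eq) e2 erefl e4).
rewrite (mdif_act er erefl erefl e5 erefl e6) gnatD gnatZ.
rewrite (gnat_act u (qdg_dif_deg2 eq) e5 _ e2) (gnat_act u erefl e6 _ e4).
rewrite scalerDr scalerA -ksgnD opprD [- _ - _]addrC addrA addrK.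
by rewrite gactDl gactNl gactZl.
Qed.

Definition qdg_dif : qdg_hom M N n' := GNat qdg_dif_linear_val qdg_dif_act.

Lemma qdg_difE A p q r s (eq : q = n' + p) (er : r = n + p) (es : s = p + 1)
    (e1 : q = r + 1) (e2 : q = n + s) (x : M A p) :
  gnat_val qdg_dif eq x =
  mdif N e1 (u A p r er x) - ksgn k n *: u A s q e2 (mdif M es x).
Proof.
subst r s; rewrite /= /qdg_dif_val (eq_irrelevance e1 (qdg_dif_deg1 eq)).
by rewrite (eq_irrelevance e2 (qdg_dif_deg2 eq)).
Qed.

End QDGDif.
Arguments qdg_difE {M N n n'} e u {A p q r s} eq er es e1 e2 x.

Section QDGCurv.
Variable M : qdg_module.

Fact qdg_curv_deg1 (p q : int) : q = 2 + p -> q = p + 1 + 1.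
Proof. lia. Qed.
Fact qdg_curv_deg2 (p q : int) : q = 2 + p -> q = p + 2.
Proof. by rewrite addrC. Qed.

Definition qdg_curv_val A p q (e : q = 2 + p) (x : M A p) : M A q :=
  mdif M (qdg_curv_deg1 e) (mdif M erefl x)
  + gact M (qdg_curv_deg2 e) x (cdg_curv a A).

Fact qdg_curv_linear A p q (e : q = 2 + p) : linear (@qdg_curv_val A p q e).
Proof.
move=> c x y; rewrite /qdg_curv_val !mdif_linear gact_linear_l scalerDr.
by rewrite addrACA.
Qed.

Fact qdg_curv_act A B p q r s t (e : q = 2 + p) (er : r = p + s)
    (e1 : t = 2 + r) (e2 : t = q + s) (x : M B p) (f : cdg_hom a A B s) :
  qdg_curv_val e1 (gact M er x f) = gact M e2 (qdg_curv_val e x) f.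
Proof.
have e5 : r + 1 = p + 1 + s by rewrite er addrAC.
have e6 : r + 1 = p + (s + 1) by rewrite er addrA.
have e7 : t = p + 1 + (s + 1) by rewrite e2 e; lia.
have e8 : t = p + (s + 1 + 1) by rewrite e2 e; lia.
have e9 : s + 1 + 1 = 2 + s by lia.
have e10 : s + 1 + 1 = s + 2 by rewrite -addrA.
rewrite /qdg_curv_val (mdif_act er erefl erefl e5 erefl e6) mdifD mdifZ.
rewrite (mdif_act e5 _ (qdg_curv_deg1 e) e2 erefl e7).
rewrite (mdif_act e6 _ erefl e7 erefl e8) (dif_dif _ _ e9 e10).
rewrite ksgnS scaleNr scalerDr ksgnK addrA subrK gactDr gactNr.
rewrite (gactA e9 e8 (qdg_curv_deg2 e) e2) (gactA e10 e8 er (qdg_curv_deg2 e1)).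
by rewrite addrA subrK gactDl.
Qed.

Definition qdg_curv : qdg_hom M M 2 := GNat qdg_curv_linear qdg_curv_act.

Lemma qdg_curvE A p q r (e : q = 2 + p) (er : r = p + 1) (e1 : q = r + 1)
    (e2 : q = p + 2) (x : M A p) :
  gnat_val qdg_curv e x = mdif M e1 (mdif M er x) + gact M e2 x (cdg_curv a A).
Proof.
subst r; rewrite /= /qdg_curv_val (eq_irrelevance e1 (qdg_curv_deg1 e)).
by rewrite (eq_irrelevance e2 (qdg_curv_deg2 e)).
Qed.

End QDGCurv.
Arguments qdg_curvE M {A p q r} e er e1 e2 x.

Fact qdg_comp_linear_l (L M N : qdg_module) m n p (e : p = m + n)
    (u : qdg_hom L M n) :
  linear (fun v : qdg_hom M N m => gnat_comp e v u : qdg_hom L N p).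
Proof. by move=> c v w; apply: gnatP => A q r er x. Qed.

Fact qdg_comp_linear_r (L M N : qdg_module) m n p (e : p = m + n)
    (v : qdg_hom M N m) :
  linear (fun u : qdg_hom L M n => gnat_comp e v u : qdg_hom L N p).
Proof.
move=> c u w; apply: gnatP => A q r er x.
exact: (gnat_linear v (gnat_comp_deg e er)).
Qed.

Fact qdg_compA (K L M N : qdg_module) l m n lm mn lmn (e1 : mn = m + n)
    (e2 : lmn = l + mn) (e3 : lm = l + m) (e4 : lmn = lm + n)
    (h : qdg_hom M N l) (g : qdg_hom L M m) (f : qdg_hom K L n) :
  gnat_comp e2 h (gnat_comp e1 g f) = gnat_comp e4 (gnat_comp e3 h g) f.
Proof.
apply: gnatP => A q r er x.
have es : mn + q = m + (n + q) by rewrite e1 addrA.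
have et : r = l + (mn + q) by rewrite er e2 addrA.
have ew : r = lm + (n + q) by rewrite er e4 addrA.
rewrite (gnat_compE e2 _ _ er erefl et) (gnat_compE e4 _ _ er erefl ew).
by rewrite (gnat_compE e1 _ _ erefl erefl es) (gnat_compE e3 _ _ ew es et).
Qed.

Fact qdg_dif_linear (M N : qdg_module) n n' (e : n' = n + 1) :
  linear (@qdg_dif M N n n' e).
Proof.
move=> c u v; apply: gnatP => A p q eq x.
rewrite gnat_addE gnat_scaleE /= /qdg_dif_val !gnat_addE !gnat_scaleE.
rewrite mdif_linear !scalerDr opprD scalerN addrACA; congr (_ - _ + _).
by rewrite !scalerA mulrC.
Qed.

Fact qdg_dif_comp (L M N : qdg_module) m n p m' n' p' (e : p = m + n)
    (ep : p' = p + 1) (em : m' = m + 1) (e1 : p' = m' + n) (en : n' = n + 1)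
    (e2 : p' = m + n') (g : qdg_hom M N m) (f : qdg_hom L M n) :
  qdg_dif ep (gnat_comp e g f : qdg_hom L N p) =
    (gnat_comp e1 (qdg_dif em g) f : qdg_hom L N p')
    + ksgn k m *: (gnat_comp e2 g (qdg_dif en f) : qdg_hom L N p').
Proof.
apply: gnatP => A q r er x; rewrite gnat_addE gnat_scaleE.
have d1 : p + q = m + (n + q) by rewrite e addrA.
have d2 : r = m + (n + q) + 1 by rewrite er ep addrAC d1.
have d3 : r = p + (q + 1) by rewrite er ep -addrA [1 + q]addrC.
have d4 : n + q + 1 = n + (q + 1) by rewrite addrA.
have d5 : r = m + (n + q + 1) by rewrite d2 -addrA.
have d6 : r = p + q + 1 by rewrite er ep addrAC.
have d7 : r = m' + (n + q) by rewrite er e1 addrA.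
have d8 : n + q + 1 = n' + q by rewrite en addrAC.
rewrite (qdg_difE ep _ er erefl erefl d6 d3).
rewrite (gnat_compE e _ _ erefl erefl d1) (gnat_compE e _ _ d3 d4 d5).
rewrite (gnat_compE e1 _ _ er erefl d7) (gnat_compE e2 _ _ er d8 d5).
rewrite (qdg_difE em g d7 d1 erefl d6 d5).
rewrite (qdg_difE en f d8 erefl erefl erefl d4).
rewrite gnatD gnatN gnatZ scalerDr scalerN scalerA -ksgnD -e addrA subrK.
by [].
Qed.

Fact qdg_dif_curv (M : qdg_module) n (e : n = 2 + 1) : qdg_dif e (qdg_curv M) = 0.
Proof.
apply: gnatP => A p q eq x.
have d1 : 2 + p = p + 1 + 1 by lia.
have d2 : 2 + p = p + 2 by lia.
have d3 : q = 2 + p + 1 by rewrite eq e; lia.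
have d4 : q = 2 + (p + 1) by rewrite d3 addrA.
have d5 : q = p + 1 + 2 by rewrite d4 addrC.
have d6 : q = p + (2 + 1) by rewrite d3; lia.
rewrite (qdg_difE e (qdg_curv M) eq erefl erefl d3 d4).
rewrite (qdg_curvE _ _ erefl d1 d2) (qdg_curvE _ _ d1 d3 d5).
rewrite mdifD (mdif_act d2 d3 erefl d5 erefl d6) dif_curv gact0r scaler0 addr0.
by rewrite /ksgn expr2 mulrNN mulr1 scale1r subrr.
Qed.

Fact qdg_dif_dif (M N : qdg_module) n n' n'' (e : n' = n + 1) (e' : n'' = n' + 1)
    (e1 : n'' = 2 + n) (e2 : n'' = n + 2) (f : qdg_hom M N n) :
  qdg_dif e' (qdg_dif e f) =
    (gnat_comp e1 (qdg_curv N) f : qdg_hom M N n'')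
    - (gnat_comp e2 f (qdg_curv M) : qdg_hom M N n'').
Proof.
apply: gnatP => A p q eq x; rewrite gnat_addE gnat_oppE.
have d1 : n + p + 1 = n' + p by rewrite e addrAC.
have d2 : n + p + 1 = n + (p + 1) by rewrite addrA.
have d3 : q = n + p + 1 + 1 by rewrite eq e' e; lia.
have d4 : q = n' + (p + 1) by rewrite d3 d1 addrA.
have d5 : q = n + (p + 1 + 1) by rewrite d3 !addrA.
have d6 : q = 2 + (n + p) by rewrite d3; lia.
have d7 : q = n + p + 2 by rewrite d6 addrC.
have d8 : p + 1 + 1 = 2 + p by lia.
have d9 : p + 1 + 1 = p + 2 by lia.
rewrite (qdg_difE e' (qdg_dif e f) eq d1 erefl d3 d4).
rewrite (qdg_difE e f d1 erefl erefl erefl d2).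
rewrite (qdg_difE e f d4 d2 erefl d3 d5).
rewrite (gnat_compE e1 _ _ eq erefl d6) (gnat_compE e2 _ _ eq d8 d5).
rewrite (qdg_curvE _ _ erefl d3 d7) (qdg_curvE _ _ erefl erefl d9).
rewrite gnatD (gnat_act f erefl d9 d5 d7).
rewrite mdifD mdifN mdifZ scalerDr scalerN scalerA.
rewrite e ksgnS !mulNr ksgnM !scaleNr scale1r !opprK opprD opprK addrA.
by rewrite subrK opprD addrACA subrr addr0.
Qed.

Definition mod_qdg : cdg_category k qdg_module :=
  @CDGCategory k qdg_module qdg_hom
    (fun L M N m n p e v u => gnat_comp e v u) qdg_dif qdg_curv
    qdg_comp_linear_l qdg_comp_linear_r qdg_compA qdg_dif_linear
    qdg_dif_comp qdg_dif_curv qdg_dif_dif.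

End Modules.

Arguments gact {k ob a} M {A B m n p} e x f : rename.
Arguments mdif {k ob a} M {A n n'} e x : rename.

Section Yoneda.
Variables (k : comPzRingType) (ob : Type) (a : cdg_category k ob).

Definition yoneda_ob (A : ob) : qdg_module a :=
  @QDGModule k ob a (gmod_repr a A) (fun B n n' e x => cdg_dif a e x)
    (fun B n n' e => dif_linear e)
    (fun B C m n p m' n' p' e ep em e1 en e2 x f => dif_comp e ep em e1 en e2 x f).

Section YonedaMap.
Variables (A B : ob) (n : int) (g : cdg_hom a A B n).

Fact yoneda_map_linear C (p q : int) (e : q = n + p) :
  linear (fun x : yoneda_ob A C p => cdg_comp a e g x : yoneda_ob B C q).
Proof. exact: comp_linear_r. Qed.
Fact yoneda_map_act C D p q r s t (e : q = n + p) (er : r = p + s)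
    (e1 : t = n + r) (e2 : t = q + s) (x : yoneda_ob A D p) (f : cdg_hom a C D s) :
  cdg_comp a e1 g (gact (yoneda_ob A) er x f) = gact (yoneda_ob B) e2 (cdg_comp a e g x) f.
Proof. exact: compA. Qed.

Definition yoneda_map : cdg_hom (mod_qdg a) (yoneda_ob A) (yoneda_ob B) n :=
  GNat yoneda_map_linear yoneda_map_act.

End YonedaMap.

Fact yoneda_linear A B n : linear (@yoneda_map A B n).
Proof. by move=> c g g'; apply: gnatP => C p q e x; exact: comp_linear_l. Qed.

Fact yoneda_comp A B C m n p (e : p = m + n) (g : cdg_hom a B C m) (f : cdg_hom a A B n) :
  yoneda_map (cdg_comp a e g f) = cdg_comp (mod_qdg a) e (yoneda_map g) (yoneda_map f).
Proof. by apply: gnatP => D q r er x; apply/esym; exact: compA. Qed.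

Fact yoneda_dif A B n n' (e : n' = n + 1) (f : cdg_hom a A B n) :
  yoneda_map (cdg_dif a e f) = cdg_dif (mod_qdg a) e (yoneda_map f).
Proof.
apply: gnatP => C p q eq x /=; rewrite /qdg_dif_val /=.
by rewrite (dif_comp _ _ e eq erefl (qdg_dif_deg2 e eq)) addrK.
Qed.

Fact yoneda_curv A : yoneda_map (cdg_curv a A) = cdg_curv (mod_qdg a) (yoneda_ob A).
Proof.
apply: gnatP => B p q e x /=; rewrite /qdg_curv_val /=.
by rewrite (dif_dif _ _ e (qdg_curv_deg2 e)) subrK.
Qed.

Definition yoneda : cdg_functor a (mod_qdg a) :=
  CDGFunctor yoneda_linear yoneda_comp yoneda_dif yoneda_curv.

End Yoneda.

Section FreeCon.
Variables (k : comPzRingType) (ob : Type) (a : cdg_category k ob).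

Definition free_con : cdg_category k (con_obj (free_cdg a)) := con_cdg (free_cdg a).

Definition free_con_in_ob (A : ob) : con_obj (free_cdg a) :=
  @ConObj k (free_obj ob) (free_cdg a) (@FreeObj ob unit (fun=> A) (fun=> 0)) 0.

Fact free_con_in_deg (n : int) : n = n + (0 - 0).
Proof. by rewrite subrr addr0. Qed.

Definition free_con_in_map A B n (f : cdg_hom a A B n) :
    cdg_hom free_con (free_con_in_ob A) (free_con_in_ob B) n :=
  fun _ : unit =>
    dsum_in (V := fun _ : unit => cdg_hom a A B (n + (0 - 0)))
      (i := tt) (dcast (free_con_in_deg n) f).

Lemma free_con_in_mapE A B n (f : cdg_hom a A B n) i j :
  free_con_in_map f i j = dcast (free_con_in_deg n) f.
Proof. by case: i j => -[]; rewrite /free_con_in_map dsum_in_id. Qed.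

Fact free_con_in_linear A B n : linear (@free_con_in_map A B n).
Proof.
move=> c f g; apply: free_homP => i j.
change (free_con_in_map (c *: f + g) i j =
  c *: free_con_in_map f i j + free_con_in_map g i j).
by rewrite !free_con_in_mapE dcastD dcastZ.
Qed.

Fact free_con_in_comp A B C m n p (e : p = m + n)
    (g : cdg_hom a B C m) (f : cdg_hom a A B n) :
  free_con_in_map (cdg_comp a e g f) =
  cdg_comp free_con e (free_con_in_map g) (free_con_in_map f).
Proof.
apply: free_homP => i j; rewrite free_con_in_mapE.
change (dcast (free_con_in_deg p) (cdg_comp a e g f) =
  free_comp_entry e (free_con_in_map g) (free_con_in_map f) i j).
rewrite /free_comp_entry (fsum_single (i0 := tt)) => [|[]//].
rewrite !free_con_in_mapE.
have e1 : p + (0 - 0) = m + n by rewrite subrr addr0.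
have e2 : p + (0 - 0) = m + (n + (0 - 0)) by rewrite subrr !addr0.
by rewrite (dcast_comp _ _ e1) (comp_dcastl _ _ e2) (comp_dcastr _ _ e1).
Qed.

Fact free_con_in_dif A B n n' (e : n' = n + 1) (f : cdg_hom a A B n) :
  free_con_in_map (cdg_dif a e f) = cdg_dif free_con e (free_con_in_map f).
Proof.
pose F : cdg_hom (free_cdg a) _ _ n := free_con_in_map f.
have -> : cdg_dif (free_con) e (free_con_in_map f) = cdg_dif (free_cdg a) e F.
  change (cdg_dif (free_cdg a) e F + cdg_comp (free_cdg a) (con_deg e) 0 F
    - ksgn k n *: cdg_comp (free_cdg a) e F 0 = cdg_dif (free_cdg a) e F).
  by rewrite comp0l comp0r scaler0 subr0 addr0.
apply: free_homP => i j; rewrite free_con_in_mapE.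
change (dcast (free_con_in_deg n') (cdg_dif a e f) =
  1 *: cdg_dif a (free_dif_deg 0 0 e) (free_con_in_map f i j)).
have e1 : n' + (0 - 0) = n + 1 by rewrite subrr addr0.
by rewrite scale1r free_con_in_mapE (dcast_dif _ _ e1) (dif_dcast _ _ e1).
Qed.

Fact free_con_in_curv A :
  free_con_in_map (cdg_curv a A) = cdg_curv free_con (free_con_in_ob A).
Proof.
pose X := con_ob (free_con_in_ob A).
have -> : cdg_curv free_con (free_con_in_ob A) = cdg_curv (free_cdg a) X.
  change (cdg_curv (free_cdg a) X + cdg_dif (free_cdg a) con_deg2 0
    + cdg_comp (free_cdg a) (B := X) con_deg2 0 0 = cdg_curv (free_cdg a) X).
  by rewrite comp0r dif0 !addr0.
apply: free_homP => i j; rewrite free_con_in_mapE.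
case: i j => -[]; change (dcast (free_con_in_deg 2) (cdg_curv a A) =
  free_diag X (cdg_curv a) tt tt).
rewrite /free_diag dsum_in_id /=.
by congr dcast; exact: eq_irrelevance.
Qed.

Definition free_con_in : cdg_functor a free_con :=
  CDGFunctor free_con_in_linear free_con_in_comp free_con_in_dif free_con_in_curv.

End FreeCon.

(* Main.v *)
From mathcomp Require Import all_boot all_order all_algebra.
From mathcomp Require Import zify.
From mathcomp Require Import boolp classical_sets cardinality.
Require Import Defs.

Set Implicit Arguments.
Unset Strict Implicit.
Unset Printing Implicit Defensive.

Import GRing.Theory.
Local Open Scope classical_set_scope.
Local Open Scope ring_scope.

(** The functor is a restricted Yoneda embedding.  Write J : a -> Free(a)_con for
the inclusion A |-> (A, 0).  Every X in Free(a)_con gives the qdg-module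
  nerve J X = Free(a)_con(J -, X)
over a, and this is a strict cdg-functor because it is the Yoneda embedding of
Free(a)_con followed by restriction of modules along J, both of which are
strict cdg-functors for any cdg-categories.  For X = (+_i Sigma^(m_i) A_i, delta)
its value at B is +_i a(B, A_i)[m_i], so the nerve takes graded free values
([nerve_graded_free]); the matrix delta only enters the differential.

Full faithfulness ([nerve_ff]) is the Yoneda lemma with one generator per
summand: the i-th coordinate inclusion e_i : J A_i -> X has degree - m_i, every
x in Free(a)_con(J B, X) is the finite sum of the e_i J(x_i) over its entries
x_i ([gen_expand]), and composing a matrix with e_i returns its i-th row
([entry_comp_gen]).  A natural transformation is thus determined by the images
of the e_i, which may be prescribed arbitrarily and are the rows of a matrix.

That every graded free M is reached is a twisting argument ([twist_iso]).  A
graded isomorphism u : nerve (X, 0) -> M need not be closed, but u^-1 d(u) is a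
degree 1 endomorphism of nerve (X, 0), hence the image of some delta by
fullness.  Viewed as a map nerve (X, delta) -> M, u has differential
d(u) - u (u^-1 d(u)) = 0.

Restricted to a along J, the nerve is only isomorphic to the Yoneda embedding,
whereas an extension restricts to it on the nose.  This is repaired by
[transport]: a strict cdg-functor can be conjugated by closed degree 0
isomorphisms from its values to any other objects.  Conjugating at the objects
J A by nerve J (J A) = a(-, A), and at all others by the identity, gives the
extension; conjugation changes neither full faithfulness nor the essential
image. *)

(** * Identities and closed isomorphisms *)

Section Identities.
Variables (k : comPzRingType) (ob : Type) (a : cdg_category k ob).

Lemma identity_unique A (u v : cdg_hom a A A 0) :
  is_identity u -> is_identity v -> u = v.
Proof.
by move=> [u1 _] [_ v2]; rewrite -[RHS](u1 _ _ (esym (addr0 0))) v2.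
Qed.

(** Leibniz applied to u u = u gives d(u) = 2 d(u). *)
Lemma identity_closed A (u : cdg_hom a A A 0) n (e : n = 0 + 1) :
  is_identity u -> cdg_dif a e u = 0.
Proof.
move=> [u1 u2]; apply: (addIr (cdg_dif a e u)); rewrite add0r.
have e1 : n = n + 0 by rewrite addr0.
have e2 : n = 0 + n by rewrite add0r.
have := dif_comp (esym (addr0 0)) e e e1 e e2 u u.
by rewrite u1 u1 u2 ksgn0 scale1r.
Qed.

Lemma comp_identity_r A B (u : cdg_hom a A A 0) n p (e : p = n + 0) (e' : n = p)
    (f : cdg_hom a A B n) : is_identity u -> cdg_comp a e f u = dcast e' f.
Proof.
move=> [_ u2]; case: _ / e' e => e; rewrite u2; exact/esym/dcast_id.
Qed.

Lemma dcast_trans A B m n p (e1 : m = n) (e2 : n = p) (e3 : m = p)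
    (f : cdg_hom a A B m) : dcast e2 (dcast e1 f) = dcast e3 f.
Proof. by case: _ / e2 e3; case: _ / e1 => e3; rewrite !dcast_id. Qed.

End Identities.

Section IsoModels.
Variables (k : comPzRingType) (ob : Type) (a : cdg_category k ob).

(** Another object together with a closed isomorphism to it: the data for
replacing a value of a functor. *)
Record iso_model (X : ob) : Type := IsoModel {
  im_ob : ob;
  im_to : cdg_hom a X im_ob 0;
  im_from : cdg_hom a im_ob X 0;
  im_closed : cdg_dif a (esym (add0r 1)) im_to = 0;
  im_toK : is_identity (cdg_comp a (esym (addr0 0)) im_from im_to);
  im_fromK : is_identity (cdg_comp a (esym (addr0 0)) im_to im_from)
}.

Lemma im_to_closed X (D : iso_model X) n (e : n = 0 + 1) : cdg_dif a e (im_to D) = 0.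
Proof.
by move: (e); rewrite e => e1; rewrite (eq_irrelevance e1 (esym (add0r 1))) im_closed.
Qed.

Lemma im_from_to X (D : iso_model X) Y n (e : n = 0 + n) (f : cdg_hom a Y X n) :
  cdg_comp a e (im_from D) (cdg_comp a e (im_to D) f) = f.
Proof. by rewrite (compA e e (esym (addr0 0)) e); case: (im_toK D) => ->. Qed.

Lemma im_to_from X (D : iso_model X) Y n (e : n = 0 + n) (f : cdg_hom a Y (im_ob D) n) :
  cdg_comp a e (im_to D) (cdg_comp a e (im_from D) f) = f.
Proof. by rewrite (compA e e (esym (addr0 0)) e); case: (im_fromK D) => ->. Qed.

Lemma im_fromtoK X (D : iso_model X) Y n (e : n = n + 0) (f : cdg_hom a X Y n) :
  cdg_comp a e (cdg_comp a e f (im_from D)) (im_to D) = f.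
Proof. by rewrite -(compA (esym (addr0 0)) e e e); case: (im_toK D) => _ ->. Qed.

Lemma im_tofromK X (D : iso_model X) Y n (e : n = n + 0) (f : cdg_hom a (im_ob D) Y n) :
  cdg_comp a e (cdg_comp a e f (im_to D)) (im_from D) = f.
Proof. by rewrite -(compA (esym (addr0 0)) e e e); case: (im_fromK D) => _ ->. Qed.

(** Leibniz applied to the closed identity [from to] gives d(from) to = 0, and
[to] is invertible. *)
Lemma im_from_closed X (D : iso_model X) n (e : n = 0 + 1) :
  cdg_dif a e (im_from D) = 0.
Proof.
have e1 : n = n + 0 by rewrite addr0.
have e2 : n = 0 + n by rewrite add0r.
rewrite -[LHS](im_tofromK e1).
have := dif_comp (esym (addr0 0)) e e e1 e e2 (im_from D) (im_to D).
rewrite (identity_closed _ (im_toK D)) im_to_closed comp0r scaler0 addr0 => <-.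
by rewrite comp0l.
Qed.

Definition im_id X (u : cdg_hom a X X 0) (idu : is_identity u) : iso_model X.
Proof.
exists X u u; first exact: identity_closed.
- by have [-> _] := idu.
- by have [-> _] := idu.
Defined.

Definition im_sym X (D : iso_model X) : iso_model (im_ob D) :=
  IsoModel (im_from_closed D (esym (add0r 1))) (im_fromK D) (im_toK D).

Lemma im_trans X (D : iso_model X) Y : isomorphic a (im_ob D) Y -> isomorphic a X Y.
Proof.
move=> [u [v [du vu uv]]].
have e0 : (0 : int) = 0 + 0 by [].
exists (cdg_comp a e0 u (im_to D)), (cdg_comp a e0 (im_from D) v); split.
- rewrite (dif_comp _ _ (esym (add0r 1)) (esym (addr0 1)) (esym (add0r 1)) (esym (add0r 1))).
  by rewrite du im_to_closed comp0l comp0r scaler0 addr0.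
- rewrite (eq_irrelevance (esym (addr0 0)) e0) -(compA e0 e0 e0 e0).
  rewrite [cdg_comp a e0 v _](compA e0 e0 e0 e0) (eq_irrelevance e0 (esym (addr0 0))).
  by have [-> _] := vu; exact: im_toK.
- rewrite (eq_irrelevance (esym (addr0 0)) e0) -(compA e0 e0 e0 e0).
  by rewrite im_to_from (eq_irrelevance e0 (esym (addr0 0))).
Qed.

End IsoModels.

(** * Transporting a functor along closed isomorphisms *)

Section FunctorExt.
Variables (k : comPzRingType) (obA obB : Type).
Variables (a : cdg_category k obA) (b : cdg_category k obB).

(** Both functors carry the same object map, so that the two families of maps
have the same type and no cast is needed to compare them. *)
Lemma cdg_functor_ext (o : obA -> obB)
    (m1 m2 : forall A B n, cdg_hom a A B n -> cdg_hom b (o A) (o B) n)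
    l1 c1 d1 k1 l2 c2 d2 k2 :
  (forall A B n (f : cdg_hom a A B n), m1 A B n f = m2 A B n f) ->
  @CDGFunctor k obA obB a b o m1 l1 c1 d1 k1 = @CDGFunctor k obA obB a b o m2 l2 c2 d2 k2.
Proof.
move=> m12; have {}m12 : m1 = m2.
  by do 4! apply: functional_extensionality_dep => ?.
case: _ / m12 l2 c2 d2 k2 => l2 c2 d2 k2.
by congr CDGFunctor; exact: Prop_irrelevance.
Qed.

End FunctorExt.

Section Transport.
Variables (k : comPzRingType) (obA obB : Type).
Variables (a : cdg_category k obA) (b : cdg_category k obB).
Variables (F : cdg_functor a b) (D : forall A, iso_model b (fob F A)).

Definition transport_map A B n (f : cdg_hom a A B n) :
    cdg_hom b (im_ob (D A)) (im_ob (D B)) n :=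
  cdg_comp b (esym (add0r n)) (im_to (D B))
    (cdg_comp b (esym (addr0 n)) (fmap F f) (im_from (D A))).

Fact transport_linear A B n : linear (@transport_map A B n).
Proof.
by move=> c f g; rewrite /transport_map fmap_linear comp_linear_l comp_linear_r.
Qed.

Fact transport_comp A B C m n p (e : p = m + n)
    (g : cdg_hom a B C m) (f : cdg_hom a A B n) :
  transport_map (cdg_comp a e g f) = cdg_comp b e (transport_map g) (transport_map f).
Proof.
rewrite /transport_map fmap_comp.
set em := esym (addr0 m); set en := esym (add0r n).
rewrite -(compA e (esym (add0r p)) (esym (add0r m)) e).
rewrite -(compA en e em e) im_from_to.
by rewrite (compA (esym (addr0 n)) e e (esym (addr0 p))).
Qed.

(** Closedness of both halves of the isomorphism removes the outer terms of the
Leibniz rule. *)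
Fact transport_dif A B n n' (e : n' = n + 1) (f : cdg_hom a A B n) :
  transport_map (cdg_dif a e f) = cdg_dif b e (transport_map f).
Proof.
have e1 : n' = 1 + n by rewrite addrC.
rewrite /transport_map.
rewrite (dif_comp _ _ (esym (add0r 1)) e1 e (esym (add0r n'))).
rewrite im_to_closed comp0l [RHS]add0r ksgn0 scale1r.
rewrite (dif_comp _ _ e (esym (addr0 n')) (esym (add0r 1)) e).
by rewrite im_from_closed comp0r scaler0 [X in _ = cdg_comp b _ _ X]addr0 fmap_dif.
Qed.

(** For a closed map t of degree 0, d^2(t) = 0 says that t intertwines the
curvatures. *)
Fact transport_curv A : transport_map (cdg_curv a A) = cdg_curv b (im_ob (D A)).
Proof.
rewrite /transport_map fmap_curv.
have e1 : (2 : int) = 1 + 1 by [].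
have := dif_dif (esym (add0r 1)) e1 (esym (addr0 2)) (esym (add0r 2)) (im_to (D A)).
rewrite im_to_closed dif0 => /esym/eqP; rewrite subr_eq0 => /eqP tc.
rewrite (compA (esym (addr0 2)) (esym (add0r 2)) (esym (add0r 2)) (esym (addr0 2))).
by rewrite -tc im_tofromK.
Qed.

Definition transport : cdg_functor a b :=
  CDGFunctor transport_linear transport_comp transport_dif transport_curv.

Lemma transport_ff : fully_faithful F -> fully_faithful transport.
Proof.
move=> ffF A B n; have [G FG GF] := ffF A B n.
exists (fun h => G (cdg_comp b (esym (addr0 n))
    (cdg_comp b (esym (add0r n)) (im_from (D B)) h) (im_to (D A)))) => [f|h] /=.
  by rewrite /transport_map im_from_to im_fromtoK.
by rewrite /transport_map GF im_tofromK im_to_from.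
Qed.

Lemma transport_essential_image X :
  in_essential_image transport X <-> in_essential_image F X.
Proof.
split=> -[A AX]; exists A; first exact: im_trans AX.
by apply: (@im_trans _ _ _ _ (im_sym (D A))).
Qed.

End Transport.

(** An [iso_model] refers to an object of the target and not to the functor, so
the models chosen for F at the objects J A serve for F J as they are. *)
Lemma fcomp_transport k obA obB obC (a : cdg_category k obA)
    (b : cdg_category k obB) (c : cdg_category k obC) (F : cdg_functor b c)
    (D : forall B, iso_model c (fob F B)) (J : cdg_functor a b) :
  fcomp (transport D) J = @transport k obA obC a c (fcomp F J) (fun A => D (fob J A)).
Proof. exact: cdg_functor_ext. Qed.

(** * Restriction of modules and the restricted Yoneda embedding *)

Section Restriction.
Variables (k : comPzRingType) (obA obB : Type).
Variables (a : cdg_category k obA) (b : cdg_category k obB).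
Variable J : cdg_functor a b.

Section Ob.
Variable M : qdg_module b.

Definition restr_act A B m n p (e : p = m + n) (x : M (fob J B) m)
    (f : cdg_hom a A B n) : M (fob J A) p := gact M e x (fmap J f).

Fact restr_linear_l A B m n p (e : p = m + n) (f : cdg_hom a A B n) :
  linear (fun x : M (fob J B) m => restr_act e x f).
Proof. exact: gact_linear_l. Qed.
Fact restr_linear_r A B m n p (e : p = m + n) (x : M (fob J B) m) :
  linear (fun f : cdg_hom a A B n => restr_act e x f).
Proof. by move=> c f g; rewrite /restr_act fmap_linear gact_linear_r. Qed.
Fact restr_actA A B C l m n lm mn lmn (e1 : mn = m + n) (e2 : lmn = l + mn)
    (e3 : lm = l + m) (e4 : lmn = lm + n)
    (x : M (fob J C) l) (g : cdg_hom a B C m) (f : cdg_hom a A B n) :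
  restr_act e2 x (cdg_comp a e1 g f) = restr_act e4 (restr_act e3 x g) f.
Proof. by rewrite /restr_act fmap_comp (gactA e1 e2 e3 e4). Qed.

Definition restr_gmod : gmodule a :=
  @GModule k obA a (fun A n => M (fob J A) n) restr_act
    restr_linear_l restr_linear_r restr_actA.

Fact restr_mdif_act A B m n p m' n' p' (e : p = m + n) (ep : p' = p + 1)
      (em : m' = m + 1) (e1 : p' = m' + n) (en : n' = n + 1) (e2 : p' = m + n')
      (x : restr_gmod B m) (f : cdg_hom a A B n) :
    mdif M ep (gact restr_gmod e x f) =
      gact restr_gmod e1 (mdif M em x : restr_gmod B m') f
      + ksgn k m *: gact restr_gmod e2 x (cdg_dif a en f).
Proof. by rewrite /= /restr_act (mdif_act e ep em e1 en e2) fmap_dif. Qed.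

Definition restr_ob : qdg_module a :=
  @QDGModule k obA a restr_gmod (fun A n n' e x => mdif M e x)
    (fun A n n' e => mdif_linear e) restr_mdif_act.

End Ob.

Definition restr_map (M N : qdg_module b) n (u : cdg_hom (mod_qdg b) M N n) :
    cdg_hom (mod_qdg a) (restr_ob M) (restr_ob N) n :=
  @GNat k obA a (restr_ob M) (restr_ob N) n
    (fun A p q e (x : M (fob J A) p) => gnat_val u e x)
    (fun A p q e => gnat_linear u e)
    (fun A B p q r s t e er e1 e2 x f => gnat_act u e er e1 e2 x (fmap J f)).

Fact restr_linear M N n : linear (@restr_map M N n).
Proof. by move=> c u v; apply: gnatP. Qed.
Fact restr_comp L M N m n p (e : p = m + n)
    (v : cdg_hom (mod_qdg b) M N m) (u : cdg_hom (mod_qdg b) L M n) :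
  restr_map (cdg_comp (mod_qdg b) e v u) =
  cdg_comp (mod_qdg a) e (restr_map v) (restr_map u).
Proof. by apply: gnatP. Qed.
Fact restr_dif M N n n' (e : n' = n + 1) (u : cdg_hom (mod_qdg b) M N n) :
  restr_map (cdg_dif (mod_qdg b) e u) = cdg_dif (mod_qdg a) e (restr_map u).
Proof. by apply: gnatP. Qed.
Fact restr_curv M :
  restr_map (cdg_curv (mod_qdg b) M) = cdg_curv (mod_qdg a) (restr_ob M).
Proof.
by apply: gnatP => A p q e x; rewrite /= /qdg_curv_val /= /restr_act fmap_curv.
Qed.

Definition restr : cdg_functor (mod_qdg b) (mod_qdg a) :=
  CDGFunctor restr_linear restr_comp restr_dif restr_curv.

(** X |-> b(J -, X). *)
Definition nerve : cdg_functor b (mod_qdg a) := fcomp restr (yoneda b).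

End Restriction.

(** * Making a graded isomorphism closed by twisting *)

Section FunctorTheory.
Variables (k : comPzRingType) (obA obB : Type).
Variables (a : cdg_category k obA) (b : cdg_category k obB).
Variable F : cdg_functor a b.

Lemma fmap0 A B n : fmap F (0 : cdg_hom a A B n) = 0.
Proof.
have := fmap_linear F 1 0 (0 : cdg_hom a A B n); rewrite !scale1r addr0 => F0.
by apply: (addIr (fmap F 0)); rewrite add0r -F0.
Qed.

Lemma fmapN A B n (f : cdg_hom a A B n) : fmap F (- f) = - fmap F f.
Proof.
by have := fmap_linear F (-1) f 0; rewrite fmap0 !addr0 !scaleN1r.
Qed.

Hypothesis ffF : fully_faithful F.

(** F v only has to be neutral for maps in the image of F; fullness exhibits the
identity of F A as such a map. *)
Lemma ff_identity A (v : cdg_hom a A A 0) :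
  is_identity v -> has_units b -> is_identity (fmap F v).
Proof.
move=> [_ v2] /(_ (fob F A)) [w [w1 w2]].
have [G FG GF] := ffF A A 0.
have -> : fmap F v = w; last by split.
rewrite -[in RHS](GF w) -(v2 _ _ (esym (addr0 0)) (G w)) fmap_comp GF.
by rewrite w1.
Qed.

End FunctorTheory.

Section Twisting.
Variables (k : comPzRingType) (obB obC : Type).
Variables (b : cdg_category k obB) (c : cdg_category k obC).
Variable F : cdg_functor (con_cdg b) c.
Hypotheses (ffF : fully_faithful F) (c_units : has_units c).

(** The twist delta is the preimage of u^-1 d(u) = w d(u); it makes u, seen as a
map out of F (X, delta), closed.  Identities of c enter because v, regarded as
a map between (X, 0) and (X, delta), is an isomorphism that F must preserve. *)
Lemma twist_iso X M (u : cdg_hom c (fob F (ConObj (0 : cdg_hom b X X 1))) M 0)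
    (w : cdg_hom c M (fob F (ConObj (0 : cdg_hom b X X 1))) 0) (v : cdg_hom b X X 0) :
  is_identity v ->
  is_identity (cdg_comp c (esym (addr0 0)) w u) ->
  is_identity (cdg_comp c (esym (addr0 0)) u w) ->
  exists delta : cdg_hom b X X 1, isomorphic c (fob F (ConObj delta)) M.
Proof.
move=> idv wu uw; set X0 := ConObj _ in u w wu uw *.
have e01 : (1 : int) = 0 + 1 by [].
have e10 : (1 : int) = 1 + 0 by [].
have e00 : (0 : int) = 0 + 0 by [].
rewrite (eq_irrelevance (esym (addr0 0)) e00) in wu uw.
have [G _ GF] := ffF X0 X0 1.
pose delta : cdg_hom b X X 1 := G (cdg_comp c e01 w (cdg_dif c e01 u)).
have Fdelta : fmap F (delta : cdg_hom (con_cdg b) X0 X0 1) =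
  cdg_comp c e01 w (cdg_dif c e01 u) by exact: GF.
exists delta; pose Xd := ConObj delta.
(* The same morphism v of b with its two twisted readings; neither need be closed. *)
pose j : cdg_hom (con_cdg b) Xd X0 0 := v.
pose j' : cdg_hom (con_cdg b) X0 Xd 0 := v.
have [v1 v2] := idv.
have jj' : is_identity (cdg_comp (con_cdg b) e00 j j').
  have -> : cdg_comp (con_cdg b) e00 j j' = v by exact: v1.
  by split=> *; [exact: v1 | exact: v2].
have j'j : is_identity (cdg_comp (con_cdg b) e00 j' j).
  have -> : cdg_comp (con_cdg b) e00 j' j = v by exact: v1.
  by split=> *; [exact: v1 | exact: v2].
have Fjj' := ff_identity ffF jj' c_units.
have Fj'j := ff_identity ffF j'j c_units.
rewrite !fmap_comp in Fjj' Fj'j.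
have dj : cdg_dif (con_cdg b) e01 j =
    - cdg_comp (con_cdg b) e10 (delta : cdg_hom (con_cdg b) X0 X0 1) j.
  change (cdg_dif b e01 v + cdg_comp b (con_deg e01) 0 v
    - ksgn k 0 *: cdg_comp b e01 v delta = - cdg_comp b e10 delta v).
  by rewrite identity_closed // comp0l !add0r ksgn0 scale1r v1 v2.
exists (cdg_comp c e00 u (fmap F j)), (cdg_comp c e00 (fmap F j') w); split.
- rewrite (eq_irrelevance (esym (add0r 1)) e01) (dif_comp _ _ e01 e10 e01 e01).
  rewrite -fmap_dif dj fmapN fmap_comp Fdelta compNr ksgn0 scale1r.
  rewrite (compA e10 e01 e01 e10) (compA e01 e01 e00 e01).
  have [-> _] := uw; exact: subrr.
- rewrite (eq_irrelevance (esym (addr0 0)) e00) -(compA e00 e00 e00 e00).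
  rewrite [cdg_comp c e00 w _](compA e00 e00 e00 e00).
  by have [-> _] := wu.
- rewrite (eq_irrelevance (esym (addr0 0)) e00) -(compA e00 e00 e00 e00).
  rewrite [cdg_comp c e00 (fmap F j) _](compA e00 e00 e00 e00).
  by have [-> _] := Fjj'.
Qed.

End Twisting.

(** * Natural transformations of degree 0 *)

Section DegreeZero.
Variables (k : comPzRingType) (ob : Type) (a : cdg_category k ob).

Section Build.
Variables (M N : gmodule a) (f : forall A p, M A p -> N A p).
Hypothesis f_linear : forall A p, linear (f (A := A) (p := p)).
Hypothesis f_act : forall A B p r s (er : r = p + s) (x : M B p) (g : cdg_hom a A B s),
  f (gact M er x g) = gact N er (f x) g.

(** A component of a degree 0 transformation goes from degree p to any q with
q = 0 + p, and this equation does not hold by computation, hence the cast. *)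
Definition deg0_val A (p q : int) (e : q = 0 + p) (x : M A p) : N A q :=
  ecast d (N A d) (etrans (esym (add0r p)) (esym e)) (f x).

Lemma deg0_valE A p (e : p = 0 + p) (x : M A p) : deg0_val e x = f x.
Proof. by rewrite /deg0_val (eq_irrelevance (etrans _ _) erefl). Qed.

Fact deg0_linear A p q (e : q = 0 + p) : linear (@deg0_val A p q e).
Proof.
have eq : p = q by rewrite e add0r.
by case: _ / eq e => e c x y; rewrite !deg0_valE f_linear.
Qed.

Fact deg0_act A B p q r s t (e : q = 0 + p) (er : r = p + s)
    (e1 : t = 0 + r) (e2 : t = q + s) (x : M B p) (g : cdg_hom a A B s) :
  deg0_val e1 (gact M er x g) = gact N e2 (deg0_val e x) g.
Proof.
have eq : p = q by rewrite e add0r.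
have et : r = t by rewrite e1 add0r.
case: _ / eq e e2 => e e2; case: _ / et e1 e2 => e1 e2.
by rewrite !deg0_valE f_act (eq_irrelevance er e2).
Qed.

Definition gnat_deg0 : gnat M N 0 := GNat deg0_linear deg0_act.

End Build.

Lemma gnat_deg0P (M N : gmodule a) (u v : gnat M N 0) :
  (forall A p (e : p = 0 + p) (x : M A p), u A p p e x = v A p p e x) -> u = v.
Proof.
move=> uv; apply: gnatP => A p q e x.
have eq : p = q by rewrite e add0r.
by case: _ / eq e => e; exact: uv.
Qed.

Lemma gnat_comp_deg0 (L M N : gmodule a) (v : gnat M N 0) (u : gnat L M 0)
    A p (e : p = 0 + p) x :
  gnat_comp (esym (addr0 0)) v u A p p e x = v A p p e (u A p p e x).
Proof. exact: gnat_compE. Qed.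

Lemma gmod_isoP (M N : gmodule a) : gmod_isomorphic M N <->
  exists (u : gnat M N 0) (v : gnat N M 0),
    (forall A p (e : p = 0 + p) x, v A p p e (u A p p e x) = x) /\
    (forall A p (e : p = 0 + p) x, u A p p e (v A p p e x) = x).
Proof.
split=> -[u [v [vu uv]]]; exists u, v.
  by split=> A p e x; rewrite -gnat_comp_deg0 ?vu ?uv /= gnat_id_valE.
by split; apply: gnat_deg0P => A p e x; rewrite gnat_comp_deg0 ?vu ?uv /= gnat_id_valE.
Qed.

Section Inverse.
Variables (M N : gmodule a) (f : forall A p, M A p -> N A p).
Variable g : forall A p, N A p -> M A p.
Hypothesis f_linear : forall A p, linear (f (A := A) (p := p)).
Hypothesis f_act : forall A B p r s (er : r = p + s) (x : M B p) (h : cdg_hom a A B s),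
  f (gact M er x h) = gact N er (f x) h.
Hypothesis fK : forall A p, cancel (@f A p) (@g A p).
Hypothesis gK : forall A p, cancel (@g A p) (@f A p).

Lemma inverse_linear A p : linear (g (A := A) (p := p)).
Proof. by move=> c x y; apply: (can_inj (@fK A p)); rewrite f_linear !gK. Qed.

Lemma inverse_act A B p r s (er : r = p + s) (y : N B p) (h : cdg_hom a A B s) :
  g (gact N er y h) = gact M er (g y) h.
Proof. by apply: (can_inj (@fK A r)); rewrite f_act !gK. Qed.

Lemma gmod_iso_bij : gmod_isomorphic M N.
Proof.
apply/gmod_isoP; exists (gnat_deg0 f_linear f_act), (gnat_deg0 inverse_linear inverse_act).
by split=> A p e x /=; rewrite !deg0_valE ?fK ?gK.
Qed.

End Inverse.

Lemma gmod_iso_sym (M N : gmodule a) : gmod_isomorphic M N -> gmod_isomorphic N M.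
Proof. by move=> [u [v [vu uv]]]; exists v, u. Qed.

Lemma gmod_iso_trans (L M N : gmodule a) :
  gmod_isomorphic L M -> gmod_isomorphic M N -> gmod_isomorphic L N.
Proof.
move=> /gmod_isoP[u [v [vu uv]]] /gmod_isoP[u' [v' [vu' uv']]]; apply/gmod_isoP.
exists (gnat_comp (esym (addr0 0)) u' u), (gnat_comp (esym (addr0 0)) v v').
by split=> A p e x; rewrite !gnat_comp_deg0 ?vu' ?vu ?uv ?uv'.
Qed.

Lemma gnat_id_identity (M : qdg_module a) :
  is_identity (gnat_id M : cdg_hom (mod_qdg a) M M 0).
Proof.
split=> N n e u; apply: gnatP => A p q eq x.
  have e' : q = 0 + q by rewrite add0r.
  by rewrite (gnat_compE e _ _ eq eq e') /= gnat_id_valE.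
have e' : p = 0 + p by rewrite add0r.
by rewrite (gnat_compE e _ _ eq e' eq) /= gnat_id_valE.
Qed.

Lemma mod_qdg_units : has_units (mod_qdg a).
Proof. by move=> M; exists (gnat_id M); exact: gnat_id_identity. Qed.

Lemma isomorphic_gmod (M N : qdg_module a) :
  isomorphic (mod_qdg a) M N -> gmod_isomorphic M N.
Proof.
move=> [u [v [_ vu uv]]]; exists u, v; split.
  exact: (identity_unique vu (gnat_id_identity M)).
exact: (identity_unique uv (gnat_id_identity N)).
Qed.

Lemma gnat_deg0_closed (M N : qdg_module a) (f : forall A p, M A p -> N A p) l act :
  (forall A p p' (e : p' = p + 1) (x : M A p), f A p' (mdif M e x) = mdif N e (f A p x)) ->
  cdg_dif (mod_qdg a) (esym (add0r 1)) (@gnat_deg0 M N f l act) = 0.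
Proof.
move=> df; apply: gnatP => A p q eq x.
have er : p = 0 + p by rewrite add0r.
have e1 : q = p + 1 by rewrite eq addrC.
have e2 : q = 0 + q by rewrite add0r.
rewrite (qdg_difE _ _ eq er e1 e1 e2) /= !deg0_valE df ksgn0 scale1r.
exact: subrr.
Qed.

End DegreeZero.

(** * On the image of a fully faithful J the nerve is the Yoneda embedding *)

Section NerveYoneda.
Variables (k : comPzRingType) (obA obB : Type).
Variables (a : cdg_category k obA) (b : cdg_category k obB).
Variables (J : cdg_functor a b).
Variable K : forall A B n, cdg_hom b (fob J A) (fob J B) n -> cdg_hom a A B n.
Hypothesis JK : forall A B n, cancel (@fmap _ _ _ _ _ J A B n) (@K A B n).
Hypothesis KJ : forall A B n, cancel (@K A B n) (@fmap _ _ _ _ _ J A B n).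
Variable A : obA.

Let NA : qdg_module a := fob (nerve J) (fob J A).

Definition nerve_from : gnat (yoneda_ob a A) NA 0 :=
  @gnat_deg0 k obA a (yoneda_ob a A) NA (fun B p x => fmap J x)
    (fun B p => @fmap_linear _ _ _ _ _ J B A p)
    (fun B C p r s er x g => fmap_comp J er x g).

Definition nerve_to : gnat NA (yoneda_ob a A) 0 :=
  @gnat_deg0 k obA a NA (yoneda_ob a A) (fun B p x => K x)
    (@inverse_linear k obA a (yoneda_ob a A) NA (fun B p x => fmap J x)
      (fun B p x => K x)
      (fun B p => @fmap_linear _ _ _ _ _ J B A p)
      (fun B p => @JK B A p) (fun B p => @KJ B A p))
    (@inverse_act k obA a (yoneda_ob a A) NA (fun B p x => fmap J x)
      (fun B p x => K x)
      (fun B C p r s er x g => fmap_comp J er x g)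
      (fun B p => @JK B A p) (fun B p => @KJ B A p)).

(** The inverse K of J gives b(J -, J A) = a(-, A). *)
Definition nerve_model : iso_model (mod_qdg a) NA.
Proof.
exists (yoneda_ob a A) nerve_to nerve_from.
- apply: gnat_deg0_closed => B p p' e x; apply: (can_inj (@JK _ _ _)).
  by rewrite KJ /= fmap_dif KJ.
- suff -> : cdg_comp (mod_qdg a) (esym (addr0 0)) nerve_from nerve_to = gnat_id NA
    by exact: gnat_id_identity.
  apply: gnat_deg0P => B p e x; rewrite [LHS]gnat_comp_deg0 /= !deg0_valE gnat_id_valE.
  exact: KJ.
- suff -> : cdg_comp (mod_qdg a) (esym (addr0 0)) nerve_to nerve_from =
      gnat_id (yoneda_ob a A) by exact: gnat_id_identity.
  apply: gnat_deg0P => B p e x; rewrite [LHS]gnat_comp_deg0 /= !deg0_valE gnat_id_valE.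
  exact: JK.
Defined.

End NerveYoneda.

(** Under the identification by K, composition with J f becomes
x |-> K (J f J x) = f x. *)
Lemma transport_nerve_model k obA obB (a : cdg_category k obA)
    (b : cdg_category k obB) (J : cdg_functor a b)
    (K : forall A B n, cdg_hom b (fob J A) (fob J B) n -> cdg_hom a A B n)
    (JK : forall A B n, cancel (@fmap _ _ _ _ _ J A B n) (@K A B n))
    (KJ : forall A B n, cancel (@K A B n) (@fmap _ _ _ _ _ J A B n)) :
  @transport _ _ _ _ _ (fcomp (nerve J) J) (nerve_model JK KJ) = yoneda a.
Proof.
apply: cdg_functor_ext => A B n f; apply: gnatP => C p q e x.
have e0p : p = 0 + p by rewrite add0r.
have e0q : q = 0 + q by rewrite add0r.
rewrite /transport_map.
rewrite [LHS](gnat_compE (esym (add0r n)) _ _ e e e0q).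
rewrite (gnat_compE (esym (addr0 n)) _ _ e e0p e) /= !deg0_valE.
by rewrite -fmap_comp JK.
Qed.

(** * The nerve of the inclusion into Free(a)_con *)

Section FreeNerve.
Variables (k : comPzRingType) (ob : Type) (a : cdg_category k ob).

Let J := free_con_in a.
Let N : cdg_functor (free_con a) (mod_qdg a) := nerve J.

Fact free_con_out_deg (n : int) : n + (0 - 0) = n.
Proof. by rewrite subrr addr0. Qed.

(** A map between one-term sums is a 1 x 1 matrix. *)
Definition free_con_out A B n (x : cdg_hom (free_con a) (fob J A) (fob J B) n) :
  cdg_hom a A B n := dcast (free_con_out_deg n) (x tt tt).

Lemma free_con_inK A B n : cancel (@fmap _ _ _ _ _ J A B n) (@free_con_out A B n).
Proof.
move=> f; rewrite /free_con_out [X in dcast _ X]free_con_in_mapE.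
by rewrite (dcast_trans _ _ erefl) dcast_id.
Qed.

Lemma free_con_outK A B n : cancel (@free_con_out A B n) (@fmap _ _ _ _ _ J A B n).
Proof.
move=> x; apply: free_homP => -[] [].
apply: etrans (free_con_in_mapE _ tt tt) _.
by rewrite /free_con_out (dcast_trans _ _ erefl) dcast_id.
Qed.

Lemma free_con_in_ob_inj : injective (@free_con_in_ob k ob a).
Proof.
move=> A B AB.
have [_ //] : exists i : fidx (con_ob (free_con_in_ob a B)), fcomponent i = A.
by rewrite -AB; exists tt.
Qed.

Section Entries.
Variable X : con_obj (free_cdg a).

(** The source J B has a single summand, so a map out of it is a column indexed
by the summands of X. *)
Definition entry B p (x : cdg_hom (free_con a) (fob J B) X p) (i : fidx (con_ob X)) :
  cdg_hom a B (fcomponent i) (p + (fsh i - 0)) := x tt i.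

Lemma entryP B p (x y : cdg_hom (free_con a) (fob J B) X p) :
  (forall i, entry x i = entry y i) -> x = y.
Proof. by move=> xy; apply: free_homP => -[]. Qed.

Lemma entry_act B C m n p (e : p = m + n) (x : cdg_hom (free_con a) (fob J B) X m)
    (f : cdg_hom a C B n) i (e' : p + (fsh i - 0) = m + (fsh i - 0) + n) :
  entry (cdg_comp (free_con a) e x (fmap J f)) i = cdg_comp a e' (entry x i) f.
Proof.
change (free_comp_entry e x (free_con_in_map f) tt i = cdg_comp a e' (entry x i) f).
rewrite /free_comp_entry (fsum_single (i0 := tt)) => [|[]//].
by rewrite free_con_in_mapE; exact: comp_dcastr.
Qed.

Lemma entry_sum B p (I : Type) (s : seq I)
    (x : I -> cdg_hom (free_con a) (fob J B) X p) i :
  entry (\sum_(j <- s) x j) i = \sum_(j <- s) entry (x j) i.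
Proof. by apply: (big_morph (fun z => entry z i)). Qed.

End Entries.

Variable u : forall A, cdg_hom a A A 0.
Hypothesis idu : forall A, is_identity (u A).

Section Generators.
Variable X : con_obj (free_cdg a).

Fact free_gen_deg (s : int) : 0 = - s + (s - 0).
Proof. by rewrite subr0 addNr. Qed.

(** The inclusion of the i-th summand; its degree undoes the shift. *)
Definition free_gen (i : fidx (con_ob X)) :
    cdg_hom (free_con a) (fob J (fcomponent i)) X (- fsh i) :=
  fun _ : unit => dsum_in (V := fun j : fidx (con_ob X) =>
      cdg_hom a (fcomponent i) (fcomponent j) (- fsh i + (fsh j - 0)))
    (dcast (free_gen_deg (fsh i)) (u (fcomponent i))).
Arguments free_gen : clear implicits.

Lemma entry_comp_gen (Y : con_obj (free_cdg a)) n p (i : fidx (con_ob X))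
    (e : p = n + - fsh i) (g : cdg_hom (free_con a) X Y n) (l : fidx (con_ob Y))
    (e' : n + (fsh l - fsh i) = p + (fsh l - 0)) :
  entry (cdg_comp (free_con a) e g (free_gen i)) l =
  dcast e' ((g : free_hom a (con_ob X) (con_ob Y) n) i l).
Proof.
change (free_comp_entry e g (free_gen i) tt l =
  dcast e' ((g : free_hom a (con_ob X) (con_ob Y) n) i l)).
rewrite /free_comp_entry (fsum_single (i0 := i)) => [|j ij]; last first.
  by rewrite /free_gen dsum_in_neq // comp0r.
rewrite /free_gen dsum_in_id.
have e0 : p + (fsh l - 0) = n + (fsh l - fsh i) + 0 by lia.
by rewrite (comp_dcastr _ _ e0) (comp_identity_r _ e').
Qed.

Fact gen_expand_deg (p s : int) : p = - s + (p + (s - 0)).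
Proof. lia. Qed.

(** A column has finitely many nonzero entries, and its i-th entry is reached from
the generator e_i alone. *)
Lemma gen_expand B p (x : cdg_hom (free_con a) (fob J B) X p) :
  exists s : seq (fidx (con_ob X)),
    x = \sum_(i <- s) cdg_comp (free_con a) (gen_expand_deg p (fsh i))
          (free_gen i) (fmap J (entry x i)).
Proof.
have [s us s0] := dsum_supp ((x : free_hom a _ (con_ob X) p) tt).
exists s; apply: entryP => l; rewrite entry_sum.
pose G (i : {classic (fidx (con_ob X))}) :=
  entry (cdg_comp (free_con a) (gen_expand_deg p (fsh i))
          (free_gen i) (fmap J (entry x i))) l.
have G0 i : i \notin s -> G i = 0.
  move=> /s0 xi; rewrite /G /entry xi fmap0 comp0r //.
rewrite -[RHS](fsum_seq us G0) (fsum_single (i0 := l)) => [|i il].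
  rewrite /G.
  have e1 : p + (fsh l - 0) = - fsh l + (fsh l - 0) + (p + (fsh l - 0)) by lia.
  rewrite (entry_act _ _ _ e1) {2}/entry /free_gen dsum_in_id.
  have e2 : p + (fsh l - 0) = 0 + (p + (fsh l - 0)) by rewrite add0r.
  rewrite (comp_dcastl _ _ e2).
  by have [-> _] := idu (fcomponent l).
have e1 : p + (fsh l - 0) = - fsh i + (fsh l - 0) + (p + (fsh i - 0)) by lia.
have g0 : entry (free_gen i) l = 0 
  by rewrite /entry /free_gen dsum_in_neq // => /esym.
by rewrite /G (entry_act _ _ _ e1) g0 comp0l.
Qed.

(** Naturality moves the coefficients of [gen_expand] out, leaving the values at
the generators. *)
Lemma gen_ext (M : gmodule a) n (r t : gnat (restr_gmod J (yoneda_ob (free_con a) X)) M n) :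
  (forall i q (e : q = n + - fsh i), r _ _ _ e (free_gen i) = t _ _ _ e (free_gen i)) ->
  r = t.
Proof.
move=> rt; apply: gnatP => B p q e x.
have [s ->] := gen_expand x.
have sumE (v : gnat (restr_gmod J (yoneda_ob (free_con a) X)) M n)
    (F : fidx (con_ob X) -> cdg_hom (free_con a) (fob J B) X p) :
    v B p q e (\sum_(i <- s) F i) = \sum_(i <- s) v B p q e (F i).
  by apply: (big_morph (v B p q e)) => [y z|]; [exact: gnatD | exact: gnat0].
rewrite !sumE; apply: eq_bigr => i _.
have e2 : q = n + - fsh i + (p + (fsh i - 0)) by rewrite e; lia.
rewrite [LHS](gnat_act r erefl (gen_expand_deg p (fsh i)) e e2).
by rewrite [RHS](gnat_act t erefl (gen_expand_deg p (fsh i)) e e2) rt.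
Qed.

End Generators.
Arguments free_gen {X} i.

(** The matrix of a transformation r has r(e_i) as its i-th row.  Rows are finitely
supported since r(e_i) is a column of finite support; no finiteness is required
across different i, in accordance with the product over i in Free(a). *)
Lemma nerve_ff : fully_faithful N.
Proof.
move=> X Y n.
have dg (i : fidx (con_ob X)) (l : fidx (con_ob Y)) :
    n + - fsh i + (fsh l - 0) = n + (fsh l - fsh i) by lia.
pose G (r : cdg_hom (mod_qdg a) (fob N X) (fob N Y) n) (i : fidx (con_ob X))
    (l : fidx (con_ob Y)) : free_entry a n i l :=
  dcast (dg i l) (entry (r _ _ _ (erefl (n + - fsh i)) (free_gen i)) l).
have finG r i : finite_set [set l | G r i l <> 0].
  apply: sub_finite_set (dsum_fin ((r _ _ _ (erefl (n + - fsh i)) (free_gen i)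
    : free_hom a _ (con_ob Y) _) tt)) => l /= nz x0; apply: nz.
  by rewrite /G /entry x0 dcast0.
exists (fun r => (fun i => DSum (finG r i)) : free_hom a (con_ob X) (con_ob Y) n).
  move=> f; apply: free_homP => i l; rewrite /= /G /=.
  rewrite (entry_comp_gen _ _ (esym (dg i l))).
  by rewrite (dcast_trans _ _ erefl) dcast_id.
move=> r; apply: (@gen_ext X (fob N Y)) => i q e; subst q; apply: entryP => l.
rewrite [LHS](entry_comp_gen _ _ (esym (dg i l))) /= /G.
by rewrite (dcast_trans _ _ erefl) dcast_id.
Qed.

Lemma free_diag_identity (X : free_obj ob) :
  is_identity (free_diag X u : cdg_hom (free_cdg a) X X 0).
Proof.
split=> Y n e f; apply: free_homP => i j.
  have e' : n + (fsh j - fsh i) = 0 + (n + (fsh j - fsh i)) by rewrite add0r.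
  by rewrite [LHS](free_diag_compE _ _ _ e'); case: (idu (fcomponent j)) => ->.
have e' : n + (fsh j - fsh i) = n + (fsh j - fsh i) + 0 by rewrite addr0.
by rewrite [LHS](free_comp_diagE _ _ _ e'); case: (idu (fcomponent i)) => _ ->.
Qed.

Lemma nerve_graded_free (X : con_obj (free_cdg a)) :
  gmod_isomorphic (fob N X)
    (gmod_dsum (fun i : fidx (con_ob X) => gmod_shift (fsh i) (gmod_repr a (fcomponent i)))).
Proof.
set S := gmod_dsum _.
have d1 (n s : int) : n + (s - 0) = n + s by rewrite subr0.
pose f_val B p (x : fob N X B p) i : cdg_hom a B (fcomponent i) (p + fsh i) :=
  dcast (d1 p (fsh i)) (entry x i).
have f_fin B p x : finite_set [set i | @f_val B p x i <> 0].
  apply: sub_finite_set (dsum_fin ((x : free_hom a _ (con_ob X) _) tt)) => l /= nz x0.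
  by apply: nz; rewrite /f_val /entry x0 dcast0.
pose f B p (x : fob N X B p) : S B p := DSum (@f_fin B p x).
pose g_val B p (y : S B p) i : cdg_hom a B (fcomponent i) (p + (fsh i - 0)) :=
  dcast (esym (d1 p (fsh i))) ((y : dsum _) i).
have g_fin B p y : finite_set [set i | @g_val B p y i <> 0].
  apply: sub_finite_set (dsum_fin (y : dsum _)) => l /= nz x0.
  by apply: nz; rewrite /g_val x0 dcast0.
pose g B p (y : S B p) : fob N X B p :=
  (fun _ : unit => DSum (@g_fin B p y)) : free_hom a (con_ob (fob J B)) (con_ob X) p.
have gf B p x : g B p (f B p x) = x.
  apply: entryP => i; rewrite /entry /g /= /g_val /= /f_val.
  by rewrite (dcast_trans _ _ erefl) dcast_id.
have fg B p y : f B p (g B p y) = y.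
  apply: dsumP => i; rewrite /= /f_val /entry /g /= /g_val.
  by rewrite (dcast_trans _ _ erefl) dcast_id.
have f_lin B p : linear (@f B p).
  by move=> c x y; apply: dsumP => i; rewrite /= /f_val -dcastZ -dcastD.
have f_act B C p r s (er : r = p + s) (x : fob N X C p) (h : cdg_hom a B C s) :
    f B r (gact (fob N X) er x h) = gact S er (f C p x) h.
  apply: dsumP => i; rewrite /= /f_val /restr_act /=.
  have e' : r + (fsh i - 0) = p + (fsh i - 0) + s by rewrite er; lia.
  have e'' : r + fsh i = p + (fsh i - 0) + s by rewrite er; lia.
  rewrite (entry_act _ _ _ e') (dcast_comp _ _ e'') /gmod_shift_act /=.
  by rewrite (comp_dcastl _ _ e'').
exact: (gmod_iso_bij f_lin f_act gf fg).
Qed.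

(** Given a basis of M, [twist_iso] starts from the untwisted free object on it. *)
Lemma nerve_essential_image (M : qdg_module a) :
  in_essential_image N M <-> graded_free M.
Proof.
split=> [[X /isomorphic_gmod XM]|[I [A [s MS]]]].
  exists (fidx (con_ob X)), (@fcomponent _ (con_ob X)), (@fsh _ (con_ob X)).
  exact: gmod_iso_trans (gmod_iso_sym XM) (nerve_graded_free X).
pose X := FreeObj A s.
pose X0 : con_obj (free_cdg a) := ConObj (0 : cdg_hom (free_cdg a) X X 1).
have [v [w [wv vw]]] := gmod_iso_trans (nerve_graded_free X0) (gmod_iso_sym MS).
have [|||delta iso] := @twist_iso _ _ _ _ _ N nerve_ff (@mod_qdg_units k ob a) X M v w
  (free_diag X u).
- exact: free_diag_identity.
- by rewrite [cdg_comp _ _ _ _]wv; exact: gnat_id_identity.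
- by rewrite [cdg_comp _ _ _ _]vw; exact: gnat_id_identity.
by exists (ConObj delta).
Qed.

End FreeNerve.

(** * The extension of the Yoneda embedding *)

Section Extension.
Variables (k : comPzRingType) (ob : Type) (a : cdg_category k ob).

Let J := free_con_in a.

(** Excluded middle decides whether X lies in the image of the inclusion; on that
image the replacement has to be the representable module itself. *)
Definition extension_model (X : con_obj (free_cdg a)) :
    iso_model (mod_qdg a) (fob (nerve J) X) :=
  match pselect (exists A, free_con_in_ob a A = X) with
  | left inJ => let: exist A AX := cid inJ in
      ecast Y (iso_model (mod_qdg a) (fob (nerve J) Y)) AX
        (nerve_model (@free_con_inK k ob a) (@free_con_outK k ob a) A)
  | right _ => im_id (gnat_id_identity (fob (nerve J) X))
  end.

(** The object A recovered from J A is A again, as J is injective on objects. *)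
Lemma extension_model_in A :
  extension_model (free_con_in_ob a A) =
  nerve_model (@free_con_inK k ob a) (@free_con_outK k ob a) A.
Proof.
rewrite /extension_model; case: pselect => [inJ|]; last by case; exists A.
case: (cid inJ) => B BA; have AB := free_con_in_ob_inj BA.
by subst B; rewrite (Prop_irrelevance BA erefl).
Qed.

End Extension.

Theorem proposition3p14 (k : comPzRingType) (ob : Type) (a : cdg_category k ob)
    (a_units : has_units a) :
  exists Yhat : cdg_functor (free_con a) (mod_qdg a),
    [/\ fcomp Yhat (free_con_in a) = yoneda a,
        fully_faithful Yhat &
        forall M : qdg_module a, in_essential_image Yhat M <-> graded_free M].
Proof.
have [u idu] : exists u : forall A, cdg_hom a A A 0, forall A, is_identity (u A).
  by exists (fun A => sval (cid (a_units A))) => A; case: (cid _).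
exists (transport (@extension_model k ob a)); split.
- rewrite fcomp_transport -(transport_nerve_model (@free_con_inK k ob a) (@free_con_outK k ob a)).
  congr transport; apply: functional_extensionality_dep => A.
  exact: extension_model_in.
- exact: transport_ff (nerve_ff idu).
- by move=> M; rewrite transport_essential_image; exact: nerve_essential_image idu M.
Qed.
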